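(* Let $\rho\mapsto C^\sigma_\rho$, $\rho\in(-\epsilon,1)$, be a star-shaped deformation of a circular cone such that each $C_\rho^\sigma$ satisfies the regularity assumptions (i)--(iii) listed in the context. Then there are a number $0<\epsilon_0<\epsilon$ such that, for every $N\in\{0,1,2,\dots\}$, the function $\rho\mapsto\mathcal D_{N,\sigma}(\rho)$ is real analytic and not identically zero on $(-\epsilon_0,1)$, and a countable set $\mathcal Z$ such that all cones $C^\sigma_\rho$ with $\rho\in(-\epsilon_0,1)\setminus\mathcal Z$ are admissible medium cones.
   Context: **Coordinates and spherical harmonics.** A point of $\mathbb S^2$ is written $(\vartheta,\varphi)$, meaning $(\sin\vartheta\cos\varphi,\sin\vartheta\sin\varphi,\cos\vartheta)$. With $P_N$ the Legendre polynomials, $P_N^m(x)=(-1)^m(1-x^2)^{m/2}\partial_x^mP_N(x)$, $P_N^{-m}=(-1)^m\frac{(N-m)!}{(N+m)!}P_N^m$ for $0\le m\le N$, and $$Y_N^m(\varphi,\vartheta)=(-1)^m\sqrt{\tfrac{2N+1}{4\pi}\tfrac{(N-m)!}{(N+m)!}}\;e^{im\varphi}P_N^m(\cos\vartheta).$$ **Star-shaped deformation.** Let $\rho_0\in(0,\pi/2)$ and let $\sigma:[0,2\pi]\to(\rho_0,\pi/2)$ be continuous with $\sigma(0)=\sigma(2\pi)$. The star-shaped deformation of the circular cone of half-angle $\rho_0$ is the family of closed cones $C^\sigma_\rho$ with vertex at the origin and $$C^\sigma_\rho\cap\mathbb S^2=\{(\vartheta,\varphi):\ \varphi\in[0,2\pi),\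 0\le\vartheta\le\rho\,\sigma(\varphi)+(1-\rho)\rho_0\},\qquad \rho\in[-\epsilon,1],$$ where $\epsilon>0$ is small enough that $C^\sigma_{-\epsilon}$ is star-shaped, i.e. $\varphi\mapsto-\epsilon\sigma(\varphi)+(1+\epsilon)\rho_0$ takes values in $(\rho_0',\pi/2)$ for some $\rho_0'\in(0,\pi/2)$. **Regularity assumptions on a cone $C$.** (i) $C$ is contained in a strictly convex closed circular cone (half-opening angle $<\pi/2$); (ii) $C$ has a connected exterior; (iii) $C$ has a bounded cross-section $D\subset\mathbb R^2$, i.e. $C=\{(tx',t):x'\in D,\ t\ge0\}$, such that $\chi_D\in H^\tau(\mathbb R^2)$ ($L^2$-based Sobolev space) for some $\tau\in(1/4,1/2)$. **Admissible medium cone.** A closed cone $C\subset\mathbb R^3$ satisfying (i), (ii), (iii) (in suitable orthonormal coordinates) and: (iv) for any spherical harmonic $H\not\equiv0$ of arbitrary degree $N\ge0$ there is $m\in\{-N-2,\dots,N+2\}$ with $\int_{C\cap\mathbb S^2}Y_{N+2}^mH\,dS\ne0$. **Determinants.** $\mathcal D_{N,\sigma}(\rho)=\det\big(I^{k,l}_{N,\sigma}(\rho)\big)_{k,l=-N}^{N}$, where $I_{N,\sigma}^{k,l}(\rho)=\int_{C^\sigma_\rho\cap\mathbb S^2}Y_{N+2}^k\,\overline{Y_N^l}\,dS$. *)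

(* Defs.v *)
From mathcomp Require Import all_boot all_order all_algebra.
From mathcomp Require Import all_classical all_reals all_analysis.
From mathcomp Require Import complex.

Set Implicit Arguments.
Unset Strict Implicit.
Unset Printing Implicit Defensive.

Import Order.TTheory GRing.Theory Num.Theory.
Import numFieldNormedType.Exports.
Import ComplexField.Normc.
Local Open Scope classical_set_scope.
Local Open Scope complex_scope.
Local Open Scope ring_scope.

Section ComplexValuedAnalysis.
Context {R : realType}.

Definition expi (x : R) : R[i] := cos x +i* sin x.

Definition measurable_cfun d (T : measurableType d) (f : T -> R[i]) : Prop :=
  measurable_fun setT (fun x => complex.Re (f x)) /\
  measurable_fun setT (fun x => complex.Im (f x)).

Definition cintegral d (T : measurableType d) (mu : {measure set T -> \bar R})
    (A : set T) (f : T -> R[i]) : R[i] :=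
  (Rintegral mu A (fun x => complex.Re (f x))) +i*
  (Rintegral mu A (fun x => complex.Im (f x))).

(* Near each point of [A], [f] is the sum of a power series with complex
   coefficients, convergent for the modulus of R[i]. *)
Definition real_analytic_on (f : R -> R[i]) (A : set R) : Prop :=
  forall x, A x -> exists a : nat -> R[i], \forall y \near x,
    (fun n => normc (f y - \sum_(k < n) a k * ((y - x)%:C) ^+ k)) @ \oo
      --> (0 : R).

End ComplexValuedAnalysis.

Section SobolevPlane.
Context {R : realType}.

Definition leb2 :
    {measure set (measurableTypeR R * measurableTypeR R)%type -> \bar R} :=
  (@lebesgue_measure R \x @lebesgue_measure R)%E.

Definition dot2 (x y : R * R) : R := x.1 * y.1 + x.2 * y.2.

Definition L2_plane (f : R * R -> R[i]) : Prop :=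
  @measurable_cfun R _ (measurableTypeR R * measurableTypeR R)%type f /\
  (\int[leb2]_x (normc (f x) ^+ 2)%:E < +oo)%E.

Definition truncated_fourier (f : R * R -> R[i]) (r : R) (xi : R * R) : R[i] :=
  cintegral leb2 [set x | dot2 x x <= r ^+ 2]
    (fun x => f x * expi (- dot2 x xi)).

(* [F] is the Plancherel transform of [f]: the truncated Fourier integrals of
   [f] converge to [F] in L2. *)
Definition plancherel_transform (f F : R * R -> R[i]) : Prop :=
  L2_plane F /\
  (fun n : nat => \int[leb2]_xi
     (normc (F xi - truncated_fourier f n%:R xi) ^+ 2)%:E)%E @ \oo --> 0%E.

Definition sobolevH_plane (tau : R) (f : R * R -> R[i]) : Prop :=
  L2_plane f /\
  exists2 F, plancherel_transform f F &
    (\int[leb2]_xi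
       ((1 + dot2 xi xi) `^ tau * normc (F xi) ^+ 2)%:E < +oo)%E.

End SobolevPlane.

Section SphericalHarmonics.
Context {R : realType}.

(* Rodrigues' formula *)
Definition legendre (N : nat) : {poly R} :=
  ((2 ^ N * N`!)%:R)^-1 *: (('X ^+ 2 - 1) ^+ N)^`(N).

(* (1 - x^2)^(m/2) is written as a power of the square root, for |x| <= 1 *)
Definition legendre_assoc_nat (N m : nat) (x : R) : R :=
  (-1) ^+ m * Num.sqrt (1 - x ^+ 2) ^+ m * ((legendre N)^`(m)).[x].

(* Meaningful for |m| <= N only. [Negz n] is the integer - n.+1. *)
Definition legendre_assoc (N : nat) (m : int) (x : R) : R :=
  match m with
  | Posz n => legendre_assoc_nat N n x
  | Negz n => (-1) ^+ n.+1 * ((N - n.+1)`!%:R / (N + n.+1)`!%:R)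
              * legendre_assoc_nat N n.+1 x
  end.

(* For |m| <= N the integers N - m and N + m are nonnegative, so that [absz]
   is only a cast to nat. *)
Definition sphY (N : nat) (m : int) (phi theta : R) : R[i] :=
  ((-1) ^ m *
   Num.sqrt ((N.*2.+1)%:R / (4 * pi) *
             ((absz (N%:Z - m)%R)`!%:R / (absz (N%:Z + m)%R)`!%:R)))%:C
  * expi (m%:~R * phi) * (legendre_assoc N m (cos theta))%:C.

(* The order m = - N, ..., N encoded by i = 0, ..., 2N *)
Definition order_of (N : nat) (i : 'I_(N.*2.+1)) : int := (i : nat)%:Z - N%:Z.

(* Elements of the span of the Y_N^m, as functions of (phi, theta) *)
Definition spherical_harmonic (N : nat) (H : R -> R -> R[i]) : Prop :=
  exists c : 'I_(N.*2.+1) -> R[i], forall phi theta,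
    H phi theta = \sum_i c i * sphY N (order_of i) phi theta.

Definition nonzero_on_sphere (H : R -> R -> R[i]) : Prop :=
  exists phi theta : R, [/\
    0 <= phi < 2 * pi, 0 <= theta <= pi & H phi theta != 0].

End SphericalHarmonics.

Section Cones.
Context {R : realType}.

Definition vec3 (a b c : R) : 'rV[R]_3 := \row_(i < 3) [:: a; b; c]`_i.

Definition dot3 (x y : 'rV[R]_3) : R := \sum_i x 0 i * y 0 i.

Definition sphere : set 'rV[R]_3 := [set x | dot3 x x = 1].

Definition sph_point (phi theta : R) : 'rV[R]_3 :=
  vec3 (sin theta * cos phi) (sin theta * sin phi) (cos theta).

(* Integral against dS = sin theta dtheta dphi over a subset A of the sphere of
   a function given in coordinates (phi, theta) *)
Definition sphere_integral (A : set 'rV[R]_3) (f : R -> R -> R[i]) : R[i] :=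
  cintegral leb2
    [set p : R * R | [/\ 0 <= p.1 < 2 * pi, 0 <= p.2 <= pi &
                         A (sph_point p.1 p.2)]]
    (fun p => f p.1 p.2 * (sin p.2)%:C).

Definition closed_cone (C : set 'rV[R]_3) : Prop :=
  closed C /\ forall (t : R) x, 0 <= t -> C x -> C (t *: x).

(* axis spanned by the unit vector [e], half-opening angle [alpha] *)
Definition circular_cone (e : 'rV[R]_3) (alpha : R) : set 'rV[R]_3 :=
  [set x | Num.sqrt (dot3 x x) * cos alpha <= dot3 x e].

Definition in_convex_circular_cone (C : set 'rV[R]_3) : Prop :=
  exists (e : 'rV[R]_3) (alpha : R), [/\ dot3 e e = 1, 0 < alpha < pi / 2 &
                      C `<=` circular_cone e alpha].

Definition sobolev_cross_section (C : set 'rV[R]_3) : Prop :=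
  exists D : set (R * R), [/\ bounded_set D,
    C = [set x | exists (t : R) (y : R * R), [/\ 0 <= t, D y &
                                 x = vec3 (t * y.1) (t * y.2) t]] &
    exists tau : R, 1 / 4 < tau < 1 / 2 /\
                    sobolevH_plane tau (fun x => (\1_D x)%:C)].

Definition regular_cone (C : set 'rV[R]_3) : Prop :=
  [/\ in_convex_circular_cone C, connected (~` C) & sobolev_cross_section C].

(* [Q] is the orthonormal change of coordinates in which the regularity
   assumptions are required. *)
Definition admissible_medium_cone (C : set 'rV[R]_3) : Prop :=
  [/\ closed_cone C,
      exists Q : 'M[R]_3, Q *m Q^T = 1%:M /\
        regular_cone [set x *m Q | x in C] &
      forall (N : nat) (H : R -> R -> R[i]),
        spherical_harmonic N H -> nonzero_on_sphere H ->
        exists m : 'I_((N + 2).*2.+1),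
          sphere_integral (C `&` sphere)
            (fun phi theta => sphY (N + 2) (order_of m) phi theta
                              * H phi theta) != 0].

Definition star_deformation (rho0 : R) (sigma : R -> R) (eps : R) : Prop :=
  [/\ 0 < rho0 < pi / 2,
      {within `[0, 2 * pi], continuous sigma},
      sigma 0 = sigma (2 * pi),
      (forall phi : R, 0 <= phi <= 2 * pi -> rho0 < sigma phi < pi / 2) &
      0 < eps /\ exists2 rho0' : R, 0 < rho0' < pi / 2 &
        forall phi : R, 0 <= phi <= 2 * pi ->
          rho0' < - eps * sigma phi + (1 + eps) * rho0 < pi / 2].

Definition star_cone (rho0 : R) (sigma : R -> R) (rho : R) : set 'rV[R]_3 :=
  [set x | exists t phi theta : R,
     [/\ 0 <= t, 0 <= phi < 2 * pi,
         0 <= theta <= rho * sigma phi + (1 - rho) * rho0 &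
         x = t *: sph_point phi theta]].

Definition star_I (rho0 : R) (sigma : R -> R) (N : nat) (k l : int) (rho : R) :
    R[i] :=
  sphere_integral (star_cone rho0 sigma rho `&` sphere)
    (fun phi theta => sphY (N + 2) k phi theta * ((sphY N l phi theta)^*)%C).

Definition star_det (rho0 : R) (sigma : R -> R) (N : nat) (rho : R) : R[i] :=
  \det (\matrix_(k < N.*2.+1, l < N.*2.+1)
          star_I rho0 sigma N (order_of k) (order_of l) rho).

End Cones.

(* Main.v *)
Require Import Defs.
From HB Require Import structures.
From mathcomp Require Import all_boot all_order all_algebra.
From mathcomp Require Import all_classical all_reals all_analysis.
From mathcomp Require Import measurable_realfun complex ring lra zify.
Import Order.TTheory GRing.Theory Num.Theory.
Import numFieldNormedType.Exports.
Local Open Scope classical_set_scope.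
Local Open Scope ring_scope.
Set Implicit Arguments.
Unset Strict Implicit.
Unset Printing Implicit Defensive.

(** For each pair of orders k, l the integral I^{k,l}(rho) reduces, by Fubini
    and a primitive G in theta, to the integral over phi of
    e^{i(k-l)phi} G(rho s(phi) + rho0), where s = sigma - rho0 and G is the
    primitive, vanishing at 0, of a polynomial in cos theta and sin theta.
    Such a G is the restriction of an entire function of exponential type, and
    since s is bounded the same holds for the integral as a function of rho
    ([exp_type_integral], [star_I_fourier]).  Functions of exponential type
    form an algebra, so the determinant is one too: it is real analytic, and
    either it vanishes identically or its zeros are isolated, hence countable
    ([cexp_type_real_analytic], [exp_type_zeros_countable]).

    It does not vanish identically because it is nonzero at rho = 0.  There the
    cone is circular, the matrix is diagonal, and its entry of order +-m is a
    nonzero multiple of the integral over [cos rho0, 1] of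
    (1 - x^2)^m P_N^(m)(x) P_{N+2}^(m)(x).  By the Legendre equation
    this integral is a multiple of (1 - x^2)^(m+1) W(x) at x = cos rho0, where W
    is the Wronskian of P_N^(m) and P_{N+2}^(m).  Going from N - 2 to N, the
    three-term recurrence used twice writes W as a positive multiple of the
    previous Wronskian plus x times a nonnegative number; this is
    Christoffel-Darboux in the variable x^2, and it gives W > 0 for x > 0
    ([legendre_wronskian_gt0]).  As cos rho0 > 0, the value at 0 is nonzero
    for every rho0 in (0, pi/2) ([polar_primitive_neq0]).

    Outside the countable union over N of the zero sets, all determinants are
    nonzero.  The complex conjugates of the Y_N^l span the spherical harmonics
    of degree N, so an invertible matrix of integrals gives a nonzero moment
    against some Y_{N+2}^k with |k| <= N ([star_det_moments]).  The cone
    is closed because its bounded parts are compact ([closed_polar_cone]). *)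

(** * Real functions of exponential type *)

Section Jets.
Context {R : realType}.
Implicit Types (F G : nat -> R -> R) (f g : R -> R).

(** The successive derivatives F 0, F 1, F 2, ... of one function, with the
    geometric growth that characterizes entire functions of exponential type.
    The constants may depend on the bounded interval; this local form is
    preserved by products and by multiplication by the identity. *)
Definition jet F : Prop :=
  (forall j (x : R), is_derive x 1 (F j) (F j.+1 x)) /\
  forall M : R, exists C K : R, [/\ 0 <= C, 0 <= K &
    forall j x, `|x| <= M -> `|F j x| <= C * K ^+ j].

Definition exp_type f : Prop := exists2 F, jet F & F 0%N = f.

Lemma is_derive_scale (c : R) f (x d : R) :
  is_derive x 1 f d -> is_derive x 1 (fun y => c * f y) (c * d).
Proof. by move=> df; exact: is_deriveZ. Qed.

Lemma is_derive_mul f g (x d e : R) : is_derive x 1 f d ->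
  is_derive x 1 g e -> is_derive x 1 (fun y => f y * g y) (f x * e + g x * d).
Proof. by move=> df dg; exact: is_deriveM. Qed.

Lemma is_derive_continuous f f' :
  (forall x : R, is_derive x 1 f (f' x)) -> continuous f.
Proof.
move=> df x; apply/differentiable_continuous/derivable1_diffP.
by case: (df x).
Qed.

Lemma jet_continuous F j : jet F -> continuous (F j).
Proof. by move=> [dF _]; exact: is_derive_continuous (dF j). Qed.

Lemma exp_type_continuous f : exp_type f -> continuous f.
Proof. by case=> F jF <-; exact: jet_continuous. Qed.

Lemma exp_type_derivative f : exp_type f -> exists2 f', exp_type f' &
  forall x : R, is_derive x 1 f (f' x).
Proof.
case=> F [dF bF] <-; exists (F 1%N) => //; exists (fun j => F j.+1) => //.
split=> // M; have [C [K [C0 K0 FCK]]] := bF M; exists (C * K), K.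
split=> //; first exact: mulr_ge0.
by move=> j x /(FCK j.+1); rewrite exprS mulrA.
Qed.

Lemma exp_type_cst (c : R) : exp_type (fun=> c).
Proof.
exists (fun j => if j is 0%N then fun=> c else fun=> 0) => //; split.
  by case=> [|j] x; exact: is_derive_cst.
move=> M; exists `|c|, 1; split=> // -[|j] x _; rewrite expr1n mulr1 //.
by rewrite normr0.
Qed.

Lemma exp_type_id : exp_type id.
Proof.
exists (fun j => match j with 0%N => id | 1%N => fun=> 1 | _ => fun=> 0 end) => //.
split.
  move=> [|[|j]] x; [exact: is_derive_id|exact: is_derive_cst..].
move=> M; exists (1 + `|M|), 1; split=> //.
move=> [|[|j]] x xM; rewrite expr1n mulr1 /=.
- by rewrite (le_trans xM)// (le_trans (ler_norm M))// lerDr.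
- by rewrite normr1 lerDl.
- by rewrite normr0 addr_ge0.
Qed.

Lemma exp_typeD f g : exp_type f -> exp_type g -> exp_type (fun x => f x + g x).
Proof.
case=> F [dF bF] <- [G [dG bG] <-].
exists (fun j x => F j x + G j x) => //; split.
  by move=> j x; exact: is_deriveD.
move=> M; have [C [K [C0 K0 FCK]]] := bF M; have [D [L [D0 L0 GDL]]] := bG M.
exists (C + D), (K + L); split; [exact: addr_ge0..|move=> j x xM].
rewrite (le_trans (ler_normD _ _))// mulrDl lerD//.
  rewrite (le_trans (FCK _ _ xM))// ler_wpM2l// lerXn2r ?nnegrE ?addr_ge0//.
  by rewrite lerDl.
rewrite (le_trans (GDL _ _ xM))// ler_wpM2l// lerXn2r ?nnegrE ?addr_ge0//.
by rewrite lerDr.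
Qed.

(** Pascal's rule, in the shape in which differentiating the Leibniz formula
    of order j gives the one of order j + 1. *)
Lemma binom_sumS (a : nat -> nat -> R) j :
  \sum_(k < j.+2) (a k (j.+1 - k)%N *+ 'C(j.+1, k)) =
  \sum_(k < j.+1) ((a k.+1 (j - k)%N + a k (j - k).+1) *+ 'C(j, k)).
Proof.
rewrite big_ord_recl /= subn0 bin0.
under eq_bigr => k _ do rewrite /bump /= add1n binS mulrnDr subSS.
rewrite big_split /= big_ord_recr /= bin_small// mulr0n addr0.
rewrite [X in _ + X]addrC addrCA; under [RHS]eq_bigr do rewrite mulrnDl.
rewrite big_split /=; congr (_ + _); rewrite [RHS]big_ord_recl/= subn0 bin0.
congr (_ + _); apply: eq_bigr => k _; rewrite /bump/= add1n.
by rewrite subnSK.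
Qed.

(** Leibniz formula; by the binomial theorem the geometric rates add up. *)
Lemma exp_typeM f g : exp_type f -> exp_type g -> exp_type (fun x => f x * g x).
Proof.
case=> F [dF bF] <- [G [dG bG] <-].
exists (fun j x => \sum_(k < j.+1) (F k x * G (j - k)%N x *+ 'C(j, k))); last first.
  by apply/funext => x; rewrite big_ord_recl big_ord0 /= bin0 mulr1n addr0.
split.
  move=> j x; rewrite (binom_sumS (fun k l => F k x * G l x)).
  rewrite [X in is_derive _ _ X _](_ : _ =
      \sum_(k < j.+1) ((fun x => F k x * G (j - k)%N x *+ 'C(j, k)))); last first.
    by apply/funext => y; rewrite fct_sumE.
  apply: is_derive_sum => k; under eq_fun do rewrite -mulr_natl.
  have := is_derive_scale 'C(j, k)%:R
    (is_derive_mul (dF k x) (dG (j - k)%N x)).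
  by move/is_derive_eq; apply; rewrite -mulr_natl; ring.
move=> M; have [C [K [C0 K0 FCK]]] := bF M; have [D [L [D0 L0 GDL]]] := bG M.
exists (C * D), (L + K); split; [exact: mulr_ge0|exact: addr_ge0|move=> j x xM].
rewrite exprDn mulr_sumr (le_trans (ler_norm_sum _ _ _))// ler_sum// => k _.
rewrite normrMn mulrnAr lerMn2r normrM; apply/orP; right.
rewrite [leRHS](_ : _ = (C * K ^+ k) * (D * L ^+ (j - k))); last by ring.
by rewrite ler_pM// ?FCK ?GDL.
Qed.

Lemma exp_type_scale (c : R) f : exp_type f -> exp_type (fun x => c * f x).
Proof. by move=> ?; apply: exp_typeM => //; exact: exp_type_cst. Qed.

Lemma exp_typeB f g : exp_type f -> exp_type g -> exp_type (fun x => f x - g x).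
Proof.
move=> ef eg; under eq_fun do rewrite -mulN1r.
by apply: exp_typeD => //; exact: exp_type_scale.
Qed.

Lemma exp_typeX f n : exp_type f -> exp_type (fun x => f x ^+ n).
Proof.
move=> ef; elim: n => [|n ih]; first by under eq_fun do rewrite expr0; exact: exp_type_cst.
by under eq_fun do rewrite exprS; exact: exp_typeM.
Qed.

Lemma exp_type_horner (p : {poly R}) f : exp_type f -> exp_type (fun x => p.[f x]).
Proof.
move=> ef; elim/poly_ind: p => [|p c ih].
  by under eq_fun do rewrite horner0; exact: exp_type_cst.
under eq_fun do rewrite hornerMXaddC.
by apply: exp_typeD; [exact: exp_typeM|exact: exp_type_cst].
Qed.

Lemma exp_type_cos_sin : exp_type (@cos R) /\ exp_type (@sin R).
Proof.
pose F j : R -> R := match (j %% 4)%N with 0%N => @cos R | 1%N => fun x => - sin x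
  | 2%N => fun x => - cos x | _ => @sin R end.
have FE j : F j.+4 = F j.
  by rewrite /F (_ : (j.+4 %% 4 = j %% 4)%N)// -addn4 modnDr.
have jF : jet F.
  split.
    move=> j; have [n] := ubnP j; elim: n j => // n ih [|[|[|[|j]]]] jn x.
    - by rewrite /F /=; exact: is_derive_cos.
    - by rewrite /F /=; exact: is_deriveN.
    - rewrite /F /=; have /is_derive_eq := is_deriveN (is_derive_cos x).
      by apply; rewrite opprK.
    - by rewrite /F /=; exact: is_derive_sin.
    - rewrite FE -[j.+4.+1]/(j.+1.+4) FE; apply: ih.
      by move: jn; rewrite ltnS; apply: leq_trans; rewrite ltnS -addn3 leq_addr.
  move=> M; exists 1, 1; split=> // j x _; rewrite expr1n mulr1 /F.
  by case: (j %% 4)%N => [|[|[|?]]]; rewrite ?normrN ler_norml ?cos_geN1 ?cos_le1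
    ?sin_geN1 ?sin_le1.
split; first by exists F.
case: (jF) => dF bF; exists (fun j => F (j + 3)%N) => //; split=> // M.
exists 1, 1; split=> // j x _; rewrite expr1n mulr1 /F.
by case: ((j + 3) %% 4)%N => [|[|[|?]]]; rewrite ?normrN ler_norml ?cos_geN1 ?cos_le1
    ?sin_geN1 ?sin_le1.
Qed.

End Jets.

(** * Integrals depending on a parameter, and primitives *)

Section JetIntegral.
Context {R : realType}.
Notation mu := (@lebesgue_measure R).
Implicit Types (f g u s : R -> R).

Lemma continuous_bounded_itv f (a b : R) : continuous f ->
  exists2 M : R, 0 <= M & forall t, a <= t <= b -> `|f t| <= M.
Proof.
move=> cf.
have : compact (f @` `[a, b]).
  apply: continuous_compact; last exact: segment_compact.
  exact: continuous_subspaceT.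
move=> /compact_bounded[M [_ /(_ (`|M| + 1))]].
rewrite (le_lt_trans (ler_norm M)) ?ltrDl// => /(_ isT) bM.
exists (`|M| + 1); first by rewrite addr_ge0.
by move=> t tab; apply: bM; exists t => //=; rewrite in_itv.
Qed.

Lemma continuous_integrable_itv f (a b : R) : continuous f ->
  mu.-integrable `[a, b] (EFin \o f).
Proof.
move=> cf; apply: continuous_compact_integrable; first exact: segment_compact.
exact: continuous_subspaceT.
Qed.

Lemma norm_Rintegral_itv_le f (a b B : R) : a <= b -> continuous f ->
  (forall t, a <= t <= b -> `|f t| <= B) ->
  `|\int[mu]_(t in `[a, b]) f t| <= B * (b - a).
Proof.
move=> ab cf fB.
have intf := continuous_integrable_itv a b cf.
apply: (le_trans (le_normr_Rintegral _ intf)) => //.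
have -> : B * (b - a) = \int[mu]_(_ in `[a, b]) B.
  rewrite Rintegral_cst//; congr (_ * _); apply/esym.
  apply: (etrans (congr1 fine (lebesgue_measure_itv `[a, b]))).
  rewrite /= lte_fin.
  by case: ltgtP ab => // -> _; rewrite subrr.
apply: le_Rintegral => //.
- apply: (@continuous_integrable_itv (fun t => `|f t|)) => x.
  exact: (cvg_norm (cf x)).
- by apply: (@continuous_integrable_itv (fun=> B)) => x; exact: cvg_cst.
Qed.

Lemma Rintegral_FTC2 f g (a b : R) : a <= b -> continuous g ->
  (forall x : R, is_derive x 1 f (g x)) ->
  \int[mu]_(t in `[a, b]) g t = f b - f a.
Proof.
move=> ab cg df; have cf : continuous f := is_derive_continuous df.
case: (ltgtP a b) ab => // [ab _|-> _]; last first.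
  by rewrite set_itv1 Rintegral_set1 subrr.
rewrite /Rintegral (@continuous_FTC2 _ g f)//.
- exact: continuous_subspaceT.
- split=> [x _||]; first by case: (df x).
    exact: cvg_at_right_filter (cf a).
  exact: cvg_at_left_filter (cf b).
- by move=> x _; rewrite derive1E; case: (df x).
Qed.

Lemma continuous_affine_comp g s (x r : R) : continuous g -> continuous s ->
  continuous (fun t => g (x * s t + r)).
Proof.
move=> cg cs t; apply: (@cvg_comp _ _ _ (fun t => x * s t + r) g); last exact: cg.
by apply: cvgD; [apply: cvgM; [exact: cvg_cst|exact: cs]|exact: cvg_cst].
Qed.

Lemma is_derive_affine_comp g g' (c r x : R) :
  (forall y : R, is_derive y 1 g (g' y)) ->
  is_derive x 1 (fun y => g (y * c + r)) (c * g' (x * c + r)).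
Proof.
move=> dg; have d1 : is_derive x (1 : R) (fun y : R => y * c + r) c.
  have := is_deriveD (is_derive_mul (is_derive_id x 1) (is_derive_cst c x 1))
    (is_derive_cst r x 1).
  by move/is_derive_eq; apply; rewrite mulr0 add0r addr0 mulr1.
have := @is_derive1_comp _ g (fun y => y * c + r) x _ _ (dg _) d1.
by move/is_derive_eq; apply; rewrite mulrC.
Qed.

(** Differentiation under the integral sign is legitimate because, for x in a
    bounded interval and t in [a, b], the argument x s(t) + r stays in a compact
    interval, where the continuous function g' is bounded. *)
Lemma is_derive_integral (a b : R) u s g g' (r x : R) : a <= b ->
  continuous u -> continuous s -> continuous g' ->
  (forall y : R, is_derive y 1 g (g' y)) ->
  is_derive x 1 (fun x => \int[mu]_(t in `[a, b]) (u t * g (x * s t + r)))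
    (\int[mu]_(t in `[a, b]) (u t * s t * g' (x * s t + r))).
Proof.
move=> ab cu cs cg' dg.
have cg : continuous g := is_derive_continuous dg.
have [U U0 Ub] := continuous_bounded_itv a b cu.
have [S S0 Sb] := continuous_bounded_itv a b cs.
pose L := (`|x| + 1) * S + `|r|.
have [B B0 Bb] := continuous_bounded_itv (- L) L cg'.
pose h y t := u t * g (y * s t + r).
have dh (y t : R) : is_derive y 1 (h ^~ t) (u t * s t * g' (y * s t + r)).
  have := is_derive_scale (u t) (is_derive_affine_comp (s t) r y dg).
  by move/is_derive_eq; apply; rewrite mulrA.
have Ix : (`]x - 1, x + 1[%classic : set R) x by rewrite /= in_itv/= ltrBlDr ltrDl ltr01.
have hI (y : R) : (`]x - 1, x + 1[%classic : set R) y -> `|y| <= `|x| + 1.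
  rewrite /= in_itv /= => /andP[y1 y2]; rewrite -lerBlDl.
  apply: (le_trans (lerB_dist _ _)); rewrite ler_norml; lra.
have ih (y : R) : (`]x - 1, x + 1[%classic : set R) y -> mu.-integrable `[a, b] (EFin \o h y).
  move=> _; apply: continuous_integrable_itv => t.
  by apply: cvgM; [exact: cu|exact: continuous_affine_comp].
have dh1 (y t : R) : (`]x - 1, x + 1[%classic : set R) y -> (`[a, b]%classic : set R) t ->
  derivable (h^~ t) y 1 by move=> _ _; case: (dh y t).
have K0 (t : R) : 0 <= (fun=> U * S * B) t by rewrite !mulr_ge0.
have iK : mu.-integrable `[a, b] (EFin \o (fun=> U * S * B)).
  by apply: (@continuous_integrable_itv (fun=> U * S * B)) => y; exact: cvg_cst.
have dh2 (y t : R) : (`]x - 1, x + 1[%classic : set R) y -> (`[a, b]%classic : set R) t ->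
  `|partial1of2 h y t| <= U * S * B.
  move=> yI; rewrite /= in_itv /= => tab.
  rewrite partial1of2E; have [_ ->] := dh y t.
  rewrite !normrM !ler_pM ?mulr_ge0 ?Ub ?Sb//; apply: Bb.
  rewrite -ler_norml (le_trans (ler_normD _ _))// lerD2r normrM.
  by rewrite ler_pM ?Sb ?hI.
apply: DeriveDef.
  exact: (derivable_under_integral _ Ix ih dh1 K0 iK dh2).
rewrite -derive1E (differentiation_under_integral _ Ix ih dh1 K0 iK dh2)//.
apply: eq_Rintegral => t _; rewrite -/(partial1of2 h x t) partial1of2E.
by case: (dh x t).
Qed.

(** Each derivative in x brings out a factor s(t), so the geometric rate is
    multiplied by a bound on s. *)
Lemma exp_type_integral (a b : R) u s g (r : R) : a <= b ->
  continuous u -> continuous s -> exp_type g ->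
  exp_type (fun x => \int[mu]_(t in `[a, b]) (u t * g (x * s t + r))).
Proof.
move=> ab cu cs [G jG <-]; case: (jG) => dG bG.
have [U U0 Ub] := continuous_bounded_itv a b cu.
have [S S0 Sb] := continuous_bounded_itv a b cs.
have cus j : continuous (fun t => u t * s t ^+ j).
  move=> t; apply: cvgM; first exact: cu.
  by apply: (@cvg_comp _ _ _ s (fun y => y ^+ j)); [exact: cs|exact: exprn_continuous].
exists (fun j x => \int[mu]_(t in `[a, b]) (u t * s t ^+ j * G j (x * s t + r))).
  split=> [j x|M].
    under eq_Rintegral do rewrite exprSr mulrA.
    by apply: is_derive_integral => //; exact: jet_continuous.
  have [C [K [C0 K0 GCK]]] := bG (`|M| * S + `|r|).
  exists (U * C * (b - a)), (S * K); split.
  - by rewrite !mulr_ge0// subr_ge0.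
  - exact: mulr_ge0.
  move=> j x xM; rewrite mulrAC; apply: norm_Rintegral_itv_le => // [t|t tab].
    apply: cvgM; first exact: cus.
    by apply: continuous_affine_comp => //; exact: jet_continuous.
  rewrite [leRHS](_ : _ = U * S ^+ j * (C * K ^+ j)); last by rewrite exprMn; ring.
  rewrite !normrM normrX !ler_pM ?mulr_ge0 ?exprn_ge0 ?Ub//.
    by rewrite lerXn2r ?nnegrE ?Sb.
  apply: GCK; rewrite (le_trans (ler_normD _ _))// lerD2r normrM ler_pM ?Sb//.
  by rewrite (le_trans xM) ?ler_norm.
by apply/funext => x; apply: eq_Rintegral => t _; rewrite expr0 mulr1.
Qed.

(** The primitive is x times the integral of g(x t) over t in [0, 1]: in this
    form it is of exponential type by the previous results, and its derivative
    is the integral of the t-derivative of t g(x t). *)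
Lemma exp_type_primitive g : exp_type g -> exists G, [/\ exp_type G, G 0 = 0 &
  forall x : R, is_derive x 1 G (g x)].
Proof.
move=> eg; have [g' eg' dg] := exp_type_derivative eg.
have c1 : continuous (fun _ : R => 1 : R) by move=> x; exact: cvg_cst.
have cid : continuous (@id R) by move=> x; exact: cvg_id.
pose I x := \int[mu]_(t in `[0, 1]) (1 * g (x * t + 0)).
have eI : exp_type I := exp_type_integral 0 ler01 c1 cid eg.
exists (fun x => x * I x); split.
- by apply: exp_typeM => //; exact: exp_type_id.
- by rewrite mul0r.
move=> x; have dI := is_derive_integral 0 x ler01 c1 cid (exp_type_continuous eg') dg.
have := is_derive_mul (is_derive_id x 1) dI.
move/is_derive_eq; apply.
have cgx : continuous (fun t : R => g (x * t + 0)).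
  by apply: continuous_affine_comp => //; exact: exp_type_continuous.
have cg'x : continuous (fun t : R => g' (x * t + 0)).
  by apply: continuous_affine_comp => //; exact: exp_type_continuous.
have c3 : continuous (fun t : R => 1 * t * g' (x * t + 0)).
  move=> t; apply: cvgM; last exact: cg'x.
  by apply: cvgM; [exact: cvg_cst|exact: cvg_id].
have c2 : continuous (fun t : R => 1 * g (x * t + 0)).
  by move=> t; apply: cvgM; [exact: cvg_cst|exact: cgx].
rewrite mulr1 -RintegralZl//; last exact: (continuous_integrable_itv 0 1 c3).
have c4 : continuous (fun t : R => x * (1 * t * g' (x * t + 0))).
  by move=> t; apply: cvgM; [exact: cvg_cst|exact: c3].
rewrite -RintegralD//; [|exact: continuous_integrable_itv..].
have c5 : continuous (fun t : R => x * (1 * t * g' (x * t + 0)) + 1 * g (x * t + 0)).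
  by move=> t; apply: cvgD; [exact: c4|exact: c2].
have dtg (t : R) : is_derive t 1 (fun t => t * g (x * t + 0))
    (x * (1 * t * g' (x * t + 0)) + 1 * g (x * t + 0)).
  have := is_derive_mul (is_derive_id t 1) (is_derive_affine_comp x 0 t dg).
  rewrite (_ : (fun y => _) = (fun y => y * g (x * y + 0))).
    by move/is_derive_eq; apply; rewrite !(mulrC x) /=; ring.
  by apply/funext => y /=; rewrite (mulrC x).
by rewrite (Rintegral_FTC2 ler01 c5 dtg) mul1r mul0r subr0 mulr1 addr0.
Qed.

End JetIntegral.

(** * Taylor expansions *)

Section JetTaylor.
Context {R : realType}.
Implicit Types (F : nat -> R -> R) (f g : R -> R).

Lemma mean_value f f' (x y : R) : (forall z : R, is_derive z 1 f (f' z)) ->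
  exists2 c, `|c - x| <= `|y - x| & f y - f x = f' c * (y - x).
Proof.
move=> df; have cf : continuous f := is_derive_continuous df.
have MV (a b : R) : a <= b ->
    exists2 c, a <= c <= b & f b - f a = f' c * (b - a).
  move=> ab; have [c] := MVT_segment ab (fun z _ => df z) (continuous_subspaceT cf).
  by rewrite in_itv; exists c.
have [xy|/ltW yx] := leP x y.
  have [c /andP[xc cy] E] := MV _ _ xy; exists c => //.
  by rewrite !ger0_norm ?subr_ge0// lerD2r.
have [c /andP[yc cx] E] := MV _ _ yx; exists c.
  by rewrite !ler0_norm ?subr_le0// lerN2 lerD2r.
by rewrite -opprB E -mulrN opprB.
Qed.

Lemma is_derive_exprS f (x d : R) n : is_derive x 1 f d ->
  is_derive x 1 (fun y => f y ^+ n.+1) (n.+1%:R * f x ^+ n * d).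
Proof.
move=> df; elim: n => [|n ih]; first by rewrite expr0 !mul1r.
under eq_fun do rewrite exprS.
have := is_derive_mul df ih; move/is_derive_eq; apply.
by rewrite -(natr1 n.+1) exprS; ring.
Qed.

Lemma is_derive_taylor_sum (a : nat -> R) (x y : R) n :
  is_derive y 1 (fun y => \sum_(k < n.+1) a k / k`!%:R * (y - x) ^+ k)
    (\sum_(k < n) a k.+1 / k`!%:R * (y - x) ^+ k).
Proof.
under eq_fun do rewrite big_ord_recl.
have dk k : is_derive y (1 : R)
    (fun y => a k.+1 / k.+1`!%:R * (y - x) ^+ k.+1) (a k.+1 / k`!%:R * (y - x) ^+ k).
  have dyx : is_derive y (1 : R) (fun z => z - x) 1.
    have /is_derive_eq := is_deriveB (is_derive_id y 1) (is_derive_cst x y 1).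
    by apply; rewrite subr0.
  have /is_derive_eq := is_derive_scale (a k.+1 / k.+1`!%:R) (is_derive_exprS k dyx).
  apply; rewrite factS natrM mulr1. have k1 : k.+1%:R != 0 :> R by rewrite pnatr_eq0.
  have kf : k`!%:R != 0 :> R by rewrite pnatr_eq0 -lt0n fact_gt0.
  by field; rewrite kf nat1r.
have := is_deriveD (is_derive_cst (a 0%N / 0`!%:R * (y - x) ^+ 0) y 1)
  (is_derive_sum (fun k : 'I_n => dk k)).
move=> /is_derive_eq H; apply: (@eq_ind _ _ (fun h => is_derive y 1 h _)).
  by apply: H; rewrite add0r.
by apply/funext => z /=; rewrite [in LHS]/GRing.add /= fct_sumE.
Qed.

(** Without the factorial of the Lagrange remainder: the mean value theorem
    applied at each order gives only the power of |y - x|.  This suffices, since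
    the derivatives grow geometrically and y may be taken close to x. *)
Lemma taylor_bound F n j (x y B : R) :
  (forall j (x : R), is_derive x 1 (F j) (F j.+1 x)) ->
  (forall z, `|z - x| <= `|y - x| -> `|F (j + n)%N z| <= B) ->
  `|F j y - \sum_(k < n) F (j + k)%N x / k`!%:R * (y - x) ^+ k| <= B * `|y - x| ^+ n.
Proof.
move=> dF; elim: n j y => [|n ih] j y FB.
  by rewrite big_ord0 subr0 expr0 mulr1; have := FB y (lexx _); rewrite addn0.
pose f z := F j z - \sum_(k < n.+1) F (j + k)%N x / k`!%:R * (z - x) ^+ k.
have df (z : R) : is_derive z 1 f
    (F j.+1 z - \sum_(k < n) F (j.+1 + k)%N x / k`!%:R * (z - x) ^+ k).
  have := is_deriveB (dF j z) (is_derive_taylor_sum (fun k => F (j + k)%N x) x z n).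
  by move/is_derive_eq; apply; under eq_bigr do rewrite addnS -addSn.
have fx : f x = 0.
  rewrite /f big_ord_recl big1 ?addn0 ?addr0 => [|k _].
    by rewrite expr0 mulr1 fact0 divr1 subrr.
  by rewrite subrr /= expr0n /= mulr0.
have [c cxy] := mean_value x y df.
rewrite -/(f y) fx subr0 => ->; rewrite normrM exprSr mulrA ler_wpM2r//.
have B0 : 0 <= B by rewrite (le_trans _ (FB x _))// subrr normr0.
apply: (le_trans (ih j.+1 c _)) => [z zx|].
  by rewrite addSnnS; apply: FB; exact: le_trans cxy.
by rewrite ler_wpM2l// lerXn2r ?nnegrE.
Qed.

Lemma half_expr_cvg0 (C : R) : C * 2^-1 ^+ n @[n --> \oo] --> 0.
Proof.
rewrite -[X in _ --> X](mulr0 C); apply: cvgM; first exact: cvg_cst.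
by apply: cvg_expr; rewrite ger0_norm ?invr_ge0// invf_lt1// ltr1n.
Qed.

(** The radius is the same for all centers in [- M, M] and for all derivatives;
    this uniformity lets [jet_flat] propagate along an interval in finitely many
    steps. *)
Lemma jet_taylor F (M : R) : jet F -> exists2 r : R, 0 < r & forall j, exists C : R,
  forall x y n, `|x| <= M -> `|y - x| <= r ->
  `|F j y - \sum_(k < n) F (j + k)%N x / k`!%:R * (y - x) ^+ k| <= C * 2^-1 ^+ n.
Proof.
move=> [dF /(_ (M + 1))[C [K [C0 K0 FCK]]]].
have K1 : 0 < 2 * (K + 1) by rewrite mulr_gt0// ltr_wpDl.
(* The radius r satisfies K r <= 1/2 and r <= 1, so x +- r stays in the interval
   on which the derivatives are bounded. *)
exists (2 * (K + 1))^-1; first by rewrite invr_gt0.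
move=> j; exists (C * K ^+ j) => x y n xM yx.
apply: (le_trans (taylor_bound (B := C * K ^+ (j + n)) dF _)) => [z zx|].
  apply: FCK; rewrite -(subrK x z) (le_trans (ler_normD _ _))// addrC lerD//.
  rewrite (le_trans zx)// (le_trans yx)// invf_le1//.
  by rewrite (_ : 2 * (K + 1) = 1 + (2 * K + 1)); [rewrite lerDl addr_ge0 ?mulr_ge0|ring].
rewrite exprD -!mulrA ler_wpM2l// ler_wpM2l ?exprn_ge0// -exprMn.
rewrite lerXn2r ?nnegrE ?mulr_ge0// ?invr_ge0//.
apply: (le_trans (ler_wpM2l K0 yx)).
rewrite invfM mulrCA ger_pMr ?invr_gt0// ler_pdivrMr ?mul1r ?lerDl//.
exact: ltr_wpDl.
Qed.

End JetTaylor.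

(** * Zeros, and complex-valued functions of exponential type *)

Section Zeros.
Context {R : realType}.
Implicit Types (F : nat -> R -> R) (f g : R -> R).

Lemma jet_flat_near F (M : R) : jet F -> exists2 r : R, 0 < r &
  forall x y, `|x| <= M -> `|y - x| <= r ->
    (forall j, F j x = 0) -> forall j, F j y = 0.
Proof.
move=> jF; have [r r0 Fr] := jet_taylor M jF; exists r => // x y xM yx Fx j.
have [C FC] := Fr j; apply/eqP; rewrite -normr_le0.
apply: (ler_cvg_to (cvg_cst _) (half_expr_cvg0 C)); apply: nearW => n.
have := FC x y n xM yx.
by rewrite big1 ?subr0// => k _; rewrite Fx !mul0r.
Qed.

(** Identity theorem: all derivatives vanish at x, hence on a neighbourhood of
    fixed size, hence at the next of finitely many points leading to y. *)
Lemma jet_flat F x y : jet F -> (forall j, F j x = 0) -> forall j, F j y = 0.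
Proof.
move=> jF; have [r r0 Fr] := jet_flat_near (`|x| + `|y - x|) jF.
(* The segment from x to y is cut into n steps of length at most r. *)
pose n := (Num.truncn (`|y - x| / r)).+1.
have n0 : 0 < n%:R :> R by rewrite ltr0n.
have nr : `|y - x| / n%:R <= r.
  rewrite ler_pdivrMr// mulrC -ler_pdivrMr// ltW//.
  by rewrite (lt_le_trans (truncnS_gt _)).
pose z k := x + k%:R / n%:R * (y - x).
have -> : y = z n by rewrite /z divff ?gt_eqF// mul1r subrKC.
move=> Fx; have : (n <= n)%N by [].
elim: {1 3}n => [|k ih] kn; first by move=> j; rewrite /z mul0r mul0r addr0.
apply: (Fr (z k)); last exact/ih/ltnW.
  rewrite (le_trans (ler_normD _ _))// lerD2l normrM ler_piMl//.
  by rewrite ger0_norm ?divr_ge0// ler_pdivrMr// mul1r ler_nat ltnW.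
rewrite (_ : z k.+1 - z k = (y - x) / n%:R) ?normf_div ?(ger0_norm (ler0n _ n))//.
by rewrite /z -natr1; ring.
Qed.

Lemma isolated_zero f f' (x : R) : (forall z : R, is_derive z 1 f (f' z)) ->
  continuous f' -> f x = 0 -> f' x != 0 ->
  exists2 d, 0 < d & forall y, y != x -> `|y - x| < d -> f y != 0.
Proof.
move=> df cf' fx f'x.
have /nbhs_ballP[d /= d0 xd] : \forall y \near x, f' y != 0.
  exact: (cvgr_neq0 _ (cf' x) f'x).
exists d => // y yx yd; have [c cy] := mean_value x y df.
rewrite fx subr0 => ->; rewrite mulf_neq0 ?subr_eq0//.
by apply: xd; rewrite /ball /= distrC (le_lt_trans cy).
Qed.

(** Balls of half the isolation radius around the simple zeros are pairwise
    disjoint, and a disjoint family of nonempty open sets of reals is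
    countable. *)
Lemma countable_simple_zeros f f' : (forall z : R, is_derive z 1 f (f' z)) ->
  continuous f' -> countable [set x | f x = 0 /\ f' x != 0].
Proof.
move=> df cf'.
have /choice[d dP] (x : R) : exists d : R, 0 < d /\
    (f x = 0 /\ f' x != 0 -> forall y, y != x -> `|y - x| < d -> f y != 0).
  have [[fx f'x]|nx] := pselect (f x = 0 /\ f' x != 0); last by exists 1.
  by have [d d0 xd] := isolated_zero df cf' fx f'x; exists d.
apply: (@separated_open_countable R R (fun x => ball x (d x / 2))).
- by move=> x; exact: ball_open.
- by move=> x; exists x; apply: ballxx; rewrite divr_gt0// (dP x).1.
move=> x y xA yA [z []]; rewrite /ball /= => xz yz; apply/eqP/negPn/negP => xy.
have xyd : `|x - y| < d x / 2 + d y / 2.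
  by rewrite (le_lt_trans (ler_distD z _ _))// ltrD// distrC.
have [dxy|/ltW dyx] := leP (d x) (d y).
  have := (dP y).2 yA x xy; rewrite xA.1 eqxx; case/(_ _)/notF.
  by apply: (lt_le_trans xyd); lra.
have := (dP x).2 xA y; rewrite eq_sym xy yA.1 eqxx distrC; case/(_ isT _)/notF.
by apply: (lt_le_trans xyd); lra.
Qed.

(** A zero of order n is a simple zero of the derivative of order n - 1, and by
    the identity theorem every zero has finite order. *)
Lemma exp_type_zeros_countable f x0 : exp_type f -> f x0 != 0 ->
  countable [set x | f x = 0].
Proof.
case=> F jF <- Fx0.
apply: (@sub_countable _ _ _ (\bigcup_j [set x | F j x = 0 /\ F j.+1 x != 0])).
  apply: subset_card_le => x /= Fx; apply: contrapT => nx.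
  move/eqP: Fx0; apply; apply: (@jet_flat F x x0 jF) => j.
  elim: j => // j ih; apply/eqP/negPn/negP => jx.
  by apply: nx; exists j.
apply: bigcup_countable => // j _; apply: countable_simple_zeros.
  exact: jF.1.
exact: jet_continuous.
Qed.

End Zeros.

Section ComplexEntire.
Context {R : realType}.
Local Open Scope complex_scope.
Implicit Types (f g : R -> R[i]).

Definition cexp_type f : Prop :=
  exp_type (fun x => complex.Re (f x)) /\ exp_type (fun x => complex.Im (f x)).

Lemma cexp_type_cst (c : R[i]) : cexp_type (fun=> c).
Proof. by split; exact: exp_type_cst. Qed.

Lemma cexp_typeD f g : cexp_type f -> cexp_type g -> cexp_type (fun x => f x + g x).
Proof.
move=> [rf jf] [rg jg]; split.
  by under eq_fun do rewrite raddfD; exact: exp_typeD.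
by under eq_fun do rewrite raddfD; exact: exp_typeD.
Qed.

Lemma cexp_typeM f g : cexp_type f -> cexp_type g -> cexp_type (fun x => f x * g x).
Proof.
move=> [rf jf] [rg jg]; split.
  rewrite (_ : (fun x => _) = (fun x => complex.Re (f x) * complex.Re (g x) -
    complex.Im (f x) * complex.Im (g x))); last first.
    by apply/funext => x; case: (f x) (g x) => [? ?] [? ?].
  by apply: exp_typeB; exact: exp_typeM.
rewrite (_ : (fun x => _) = (fun x => complex.Re (f x) * complex.Im (g x) +
    complex.Im (f x) * complex.Re (g x))); last first.
  by apply/funext => x; case: (f x) (g x) => [? ?] [? ?].
by apply: exp_typeD; exact: exp_typeM.
Qed.

Lemma cexp_type_det n (A : R -> 'M[R[i]]_n) :
  (forall i j, cexp_type (fun x => A x i j)) -> cexp_type (fun x => \det (A x)).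
Proof.
move=> eA; rewrite /determinant.
have sumE (I : finType) (h : I -> R -> R[i]) :
    (forall i, cexp_type (h i)) -> cexp_type (fun x => \sum_i h i x).
  move=> eh; elim: (index_enum I) => [|i s ih].
    by under eq_fun do rewrite big_nil; exact: cexp_type_cst.
  by under eq_fun do rewrite big_cons; exact: cexp_typeD.
apply: sumE => s; apply: cexp_typeM; first exact: cexp_type_cst.
elim: (index_enum _) => [|i t ih].
  by under eq_fun do rewrite big_nil; exact: cexp_type_cst.
by under eq_fun do rewrite big_cons; exact: cexp_typeM.
Qed.

Lemma normc_le_ReIm (z : R[i]) :
  ComplexField.Normc.normc z <= `|complex.Re z| + `|complex.Im z|.
Proof.
case: z => a b /=; rewrite -[leRHS]ger0_norm ?addr_ge0// -sqrtr_sqr ler_wsqrtr//.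
rewrite sqrrD !real_normK ?num_real// lerD2r lerDl.
by rewrite mulrn_wge0// mulr_ge0.
Qed.

Lemma ReIm_taylor_sum (p q : nat -> R) (h : R) n :
  \sum_(k < n) (p k +i* q k) * h%:C ^+ k =
  (\sum_(k < n) p k * h ^+ k) +i* (\sum_(k < n) q k * h ^+ k).
Proof.
elim: n => [|n ih]; first by rewrite !big_ord0.
rewrite !big_ord_recr /= ih -rmorphXn.
by simpc.
Qed.

Lemma cexp_type_real_analytic f g (A : set R) : cexp_type f ->
  (forall x, A x -> \forall y \near x, g y = f y) -> real_analytic_on g A.
Proof.
move=> [[P jP Pf] [Q jQ Qf]] gf x Ax.
have [r r0 Pr] := jet_taylor `|x| jP; have [s s0 Qs] := jet_taylor `|x| jQ.
have [C PC] := Pr 0%N; have [D QD] := Qs 0%N.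
exists (fun k => (P k x / k`!%:R) +i* (Q k x / k`!%:R)).
have rs0 : 0 < Num.min r s by rewrite lt_min r0.
near=> y.
have gy : g y = f y by near: y; exact: gf.
have yx : `|y - x| <= Num.min r s.
  rewrite distrC; near: y; apply/nbhs_ballP; exists (Num.min r s) => //= z.
  by move=> /ltW.
move: yx; rewrite le_min => /andP[yr ys].
rewrite gy; apply: (@squeeze_cvgr _ _ _ _ (cst 0) (fun n => (C + D) * 2^-1 ^+ n)).
- apply: nearW => n; apply/andP; split; first by case: (_ - _) => ? ?; exact: sqrtr_ge0.
  rewrite (le_trans (normc_le_ReIm _))//.
  rewrite (ReIm_taylor_sum (fun k => P k x / k`!%:R) (fun k => Q k x / k`!%:R)).
  rewrite mulrDl lerD//.
    rewrite raddfB /= -[complex.Re (f y)]/((fun x => complex.Re (f x)) y) -Pf.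
    exact: PC.
  rewrite raddfB /= -[complex.Im (f y)]/((fun x => complex.Im (f x)) y) -Qf.
  exact: QD.
- exact: cvg_cst.
- exact: half_expr_cvg0.
Unshelve. all: by end_near. Qed.

Lemma cexp_type_zeros_countable f x0 : cexp_type f -> f x0 != 0 ->
  countable [set x | f x = 0].
Proof.
move=> [rf jf]; rewrite eq_complex /= negb_and => /orP[] fx0.
  apply: sub_countable (exp_type_zeros_countable rf fx0).
  by apply: subset_card_le => x /= ->.
apply: sub_countable (exp_type_zeros_countable jf fx0).
by apply: subset_card_le => x /= ->.
Qed.

End ComplexEntire.

(** * Derivatives of Legendre polynomials *)

(** Locked because comparing iterated derivatives of Legendre polynomials by
    computation would expand Rodrigues' formula. *)
HB.lock Definition dlegendre (R : realType) n m : {poly R} := (legendre n)^`(m).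

Section Legendre.
Context {R : realType}.
Implicit Types (p q : {poly R}) (n m N : nat) (x : R).

Local Notation L := (@legendre R).
Local Notation "'L_ ( n , m )" := (@dlegendre R n m) (at level 0).

(** Leibniz formula for a product with the variable, the only product that
    occurs when Rodrigues' formula is shifted by one degree. *)
Lemma derivn_mulX p n : ('X * p)^`(n.+1) = 'X * p^`(n.+1) + n.+1%:R * p^`(n).
Proof.
elim: n => [|n ih]; first by rewrite !derivnS !derivn0 derivM derivX; ring.
rewrite derivnS ih derivD derivM derivX -(natr1 n.+1) mulr_natl 
  derivMn -derivnS -mulr_natl.
by ring.
Qed.

Let u n : {poly R} := ('X ^+ 2 - 1) ^+ n.

Let deriv_u n : (u n.+1)^`() = (2 * n.+1)%:R *: ('X * u n).
Proof.
rewrite /u deriv_exp /= derivB derivXn (derivC 1) subr0 /= expr1.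
by rewrite scaler_nat mulrnAl -mulrnA.
Qed.

Let c n : R := ((2 ^ n * n`!)%:R)^-1.

Let cS n : c n.+1 * (2 * n.+1)%:R = c n.
Proof.
by rewrite /c expnS factS mulnACA natrM invfM mulrAC mulVf ?mul1r.
Qed.

Lemma legendre0 : L 0%N = 1.
Proof. by rewrite /legendre expr0 derivn0 expn0 fact0 muln1 invr1 scale1r. Qed.

(** Together with the next identity, this is all that is taken from Rodrigues'
    formula; the three-term recurrence and the differential equation follow. *)
Lemma deriv_legendreS n : (L n.+1)^`() = 'X * (L n)^`() + n.+1%:R * L n.
Proof.
rewrite /legendre -!/(u _) -!/(c _) !derivZ -derivnS derivSn deriv_u derivnZ.
rewrite scalerA cS derivn_mulX scalerDr.
by rewrite -!scalerAr -derivnS.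
Qed.

Lemma deriv_legendreSS n :
  (L n.+2)^`() = (L n)^`() + (2 * n + 3)%:R * L n.+1.
Proof.
have uSS : (u n.+2)^`()^`() = (2 * n.+2)%:R *:
    ((2 * n + 3)%:R * u n.+1 + (2 * n.+1)%:R *: u n).
  rewrite deriv_u derivZ derivM derivX deriv_u -scalerAr; congr (_ *: _).
  by rewrite -!mul_polyC /u !exprS; ring.
rewrite /legendre -!/(u _) -!/(c _) derivZ -derivnS derivSn derivSn uSS derivnZ.
rewrite scalerA cS derivnD scalerDr !mulr_natl derivnMn derivnZ.
by rewrite scalerA cS addrC derivZ -derivnS scalerMnr.
Qed.

Lemma dlegendreE n m : 'L_(n, m) = (L n)^`(m).
Proof. by rewrite unlock. Qed.

Lemma deriv_dlegendre n m : ('L_(n, m))^`() = 'L_(n, m.+1).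
Proof. by rewrite unlock. Qed.

(** First-order raising relation in the degree; its companion
    [dlegendre_lower] inverts it.  Eliminating one of the two degrees between
    them expresses (X^2 - 1) times a derivative through undifferentiated
    terms. *)
Lemma dlegendre_raise n m :
  'L_(n.+1, m.+1) = 'X * 'L_(n, m.+1) + (n + m.+1)%:R * 'L_(n, m).
Proof.
elim: m => [|m ih].
  by rewrite !dlegendreE !derivn1 derivn0 deriv_legendreS addn1.
rewrite -deriv_dlegendre ih derivD derivM derivX !mulr_natl derivMn.
by rewrite !deriv_dlegendre; ring.
Qed.

Lemma dlegendre_lower n m :
  'L_(n, m.+1) = 'X * 'L_(n.+1, m.+1) - (n.+1%:R - m%:R) * 'L_(n.+1, m).
Proof.
elim: m => [|m ih].
  have E1 := dlegendre_raise n.+1 0.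
  have : 'L_(n.+2, 1) = 'L_(n, 1) + (2 * n + 3)%:R * 'L_(n.+1, 0).
    by rewrite !dlegendreE derivn1 deriv_legendreSS.
  by rewrite E1 => /eqP; rewrite eq_sym -subr_eq => /eqP <-; ring.
rewrite -deriv_dlegendre ih derivB !derivM derivX derivB.
rewrite -!(polyC_natr _ n.+1) -!polyC_natr !derivC !deriv_dlegendre.
rewrite !polyC_natr.
by ring.
Qed.

(** The quantity (X^2 - 1) P_{n+1}^(m+1) has two expressions, one through
    degrees n, n+1 and one through degrees n+1, n+2. *)
Lemma dlegendre_rec n m :
  (n.+2%:R - m%:R) * 'L_(n.+2, m) =
  (2 * n + 3)%:R * ('X * 'L_(n.+1, m)) - (n + m.+1)%:R * 'L_(n, m).
Proof.
have F0 : ('X ^+ 2 - 1) * 'L_(n.+1, m.+1) =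
    (n.+1%:R - m%:R) * ('X * 'L_(n.+1, m)) - (n + m.+1)%:R * 'L_(n, m).
  by rewrite mulrBl mul1r {2}dlegendre_raise (dlegendre_lower n); ring.
have E1 : ('X ^+ 2 - 1) * 'L_(n.+1, m.+1) =
    (n.+2%:R - m%:R) * 'L_(n.+2, m) - (n.+1 + m.+1)%:R * ('X * 'L_(n.+1, m)).
  by rewrite mulrBl mul1r {2}dlegendre_lower (dlegendre_raise n.+1); ring.
by move: E1; rewrite F0 => /eqP; rewrite eq_sym subr_eq => /eqP ->; ring.
Qed.

Lemma dlegendre_gt n m : (n < m)%N -> 'L_(n, m) = 0.
Proof.
elim: n m => [|n ih] [|m]//.
  by rewrite dlegendreE legendre0 -polyC1 derivnC.
rewrite ltnS => nm; rewrite dlegendre_raise ih ?ih ?mulr0 ?addr0//.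
exact: leqW.
Qed.

Lemma dlegendre_ode n m :
  (1 - 'X ^+ 2) * 'L_(n, m.+2) - 2%:R * m.+1%:R * ('X * 'L_(n, m.+1)) +
  (n%:R - m%:R) * (n + m.+1)%:R * 'L_(n, m) = 0.
Proof.
case: n => [|n].
  rewrite (@dlegendre_gt 0 m.+1)// (@dlegendre_gt 0 m.+2)// !mulr0 subr0 add0r.
  case: m => [|m]; last by rewrite dlegendre_gt// mulr0.
  by rewrite subrr !mul0r.
rewrite mulrBl mul1r {1}dlegendre_raise (dlegendre_lower n m.+1).
by rewrite (dlegendre_lower n m); ring.
Qed.

Lemma dlegendre_diag m : exists2 k : R, 0 < k & 'L_(m, m) = k%:P.
Proof.
elim: m => [|m [k k0 E]]; first by exists 1; rewrite ?ltr01// dlegendreE legendre0.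
exists ((m + m.+1)%:R * k); first by rewrite mulr_gt0// ltr0n addnS.
rewrite dlegendre_raise E dlegendre_gt// mulr0 add0r.
by rewrite polyCM polyC_natr.
Qed.

Definition legendre_wronskian m d : {poly R} :=
  'L_((m + d)%N, m) * 'L_((m + d).+2, m.+1) -
  'L_((m + d)%N, m.+1) * 'L_((m + d).+2, m).

Let horner_natr k x : (k%:R : {poly R}).[x] = k%:R.
Proof. by rewrite -polyC_natr hornerC. Qed.

Let hornE := (horner_natr, hornerM, hornerD, hornerN, hornerX).

Let dlegendre_rec_horner m d x :
  d.+2%:R * 'L_((m + d).+2, m).[x] =
  (2 * (m + d) + 3)%:R * (x * 'L_((m + d).+1, m).[x]) -
  (2 * m + d.+1)%:R * 'L_((m + d)%N, m).[x].
Proof.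
have /(congr1 (horner^~ x)) := dlegendre_rec (m + d) m.
rewrite !hornE => E.
rewrite (_ : d.+2%:R = (m + d).+2%:R - m%:R); last by ring.
by rewrite E; ring.
Qed.

Let dlegendre_rec_deriv_horner m d x :
  d.+2%:R * 'L_((m + d).+2, m.+1).[x] =
  (2 * (m + d) + 3)%:R * ('L_((m + d).+1, m).[x] + x * 'L_((m + d).+1, m.+1).[x]) -
  (2 * m + d.+1)%:R * 'L_((m + d)%N, m.+1).[x].
Proof.
have /(congr1 (fun p => (p^`()).[x])) := dlegendre_rec (m + d) m.
rewrite -!polyC_natr !(derivM, derivB, derivC, derivX, deriv_dlegendre).
rewrite !(hornE, hornerC, subr0, oppr0, mul0r, add0r, mul1r) => E.
rewrite (_ : d.+2%:R = (m + d).+2%:R - m%:R); last by ring.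
by rewrite E; ring.
Qed.

(** With p_d = P_{m+d}^(m)(x) and q_d its derivative, three successive uses of
    the recurrence and of its derivative give
    s_d (d+3) (d+4) w_{d+2} = s_{d+2} (2 s_d s_{d+1} x p_{d+2}^2 + e_d e_{d+1} w_d)
    with s_d = 2(m+d)+3 and e_d = 2m+d+1, so positivity passes from w_d to w_{d+2}. *)
Lemma legendre_wronskian_gt0 m d x : 0 < x -> 0 < (legendre_wronskian m d).[x].
Proof.
move=> x0; pose p d := 'L_((m + d)%N, m).[x]; pose q d := 'L_((m + d)%N, m.+1).[x].
have pS e : e.+2%:R * p e.+2 = (2 * (m + e) + 3)%:R * (x * p e.+1) -
    (2 * m + e.+1)%:R * p e by have := dlegendre_rec_horner m e x; rewrite -!addnS.
have qS e : e.+2%:R * q e.+2 = (2 * (m + e) + 3)%:R * (p e.+1 + x * q e.+1) -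
    (2 * m + e.+1)%:R * q e by have := dlegendre_rec_deriv_horner m e x; rewrite -!addnS.
have p0 : 0 < p 0%N.
  by rewrite /p addn0; have [k k0 ->] := dlegendre_diag m; rewrite hornerC.
have q0 : q 0%N = 0 by rewrite /q addn0 dlegendre_gt// horner0.
have q1 : q 1%N = (2 * m + 1)%:R * p 0%N.
  rewrite /q /p addn1 addn0 dlegendre_raise dlegendre_gt// mulr0 add0r.
  by rewrite !hornE; ring.
have p1 : p 1%N = (2 * m + 1)%:R * (x * p 0%N).
  have := congr1 (horner^~ x) (dlegendre_lower m m).
  rewrite dlegendre_gt// dlegendre_raise dlegendre_gt// mulr0 add0r.
  rewrite !hornE horner0 /p addn1 addn0 => /eqP; rewrite eq_sym subr_eq add0r => /eqP E.
  transitivity ((m.+1%:R - m%:R) * 'L_(m.+1, m).[x]); first by ring.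
  by rewrite -E; ring.
have q2 : 0 < q 2%N.
  rewrite -(pmulr_rgt0 _ (ltr0Sn _ 1)) qS p1 q1 q0 mulr0 subr0.
  rewrite (_ : _ + _ = 2 * ((2 * m + 1)%:R * (x * p 0%N))); last by ring.
  by rewrite !mulr_gt0// ltr0n addnS.
have p1_gt0 : 0 < p 1%N by rewrite p1 !mulr_gt0// ltr0n addnS.
have -> : (legendre_wronskian m d).[x] = p d * q d.+2 - q d * p d.+2.
  by rewrite /legendre_wronskian !hornE /p /q !addnS.
have [n] := ubnP d; elim: n d => // n ih [|[|d]] dn.
- by rewrite q0 mul0r subr0 mulr_gt0.
(* Here p 1 = x (q 1), since p 1 is a constant multiple of x. *)
- rewrite -(pmulr_rgt0 _ (ltr0Sn _ 2)).
  have -> : 3 * (p 1%N * q 3%N - q 1%N * p 3%N) = (2 * (m + 1) + 3)%:R *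
      (x * p 1%N * q 2%N + p 2%N * (p 1%N - x * q 1%N)).
    transitivity (p 1%N * (3 * q 3%N) - q 1%N * (3 * p 3%N)); first by ring.
    by rewrite qS pS; ring.
  rewrite [p 1%N - _](_ : _ = 0); last by rewrite p1 q1; ring.
  by rewrite mulr0 addr0 !mulr_gt0// ltr0n addnS.
set w := p d * q d.+2 - q d * p d.+2.
have w0 : 0 < w by apply: ih; rewrite -ltnS ltnW.
set w' := _ - _.
pose s k : R := (2 * (m + k) + 3)%:R; pose e k : R := (2 * m + k.+1)%:R.
have s0 k : 0 < s k by rewrite ltr0n addnS.
have e0 k : 0 < e k by rewrite ltr0n addnS.
pose T := p d.+2 * p d.+3 + x * (p d.+2 * q d.+3 - q d.+2 * p d.+3).
pose U := p d.+1 * p d.+2 + x * (p d.+2 * q d.+1 - q d.+2 * p d.+1).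
have E4 : d.+4%:R * w' = s d.+2 * T.
  transitivity (p d.+2 * (d.+4%:R * q d.+4) - q d.+2 * (d.+4%:R * p d.+4)).
    by rewrite /w'; ring.
  by rewrite pS qS /s /T; ring.
have E3 : d.+3%:R * T = 2 * s d.+1 * x * p d.+2 ^+ 2 - e d.+1 * U.
  transitivity (p d.+2 * (d.+3%:R * p d.+3) +
      x * (p d.+2 * (d.+3%:R * q d.+3) - q d.+2 * (d.+3%:R * p d.+3))).
    by rewrite /T; ring.
  by rewrite pS qS /s /e /U; ring.
have E2 : s d * U = - (e d * w).
  have P : s d * (x * p d.+1) = d.+2%:R * p d.+2 + e d * p d by rewrite pS subrK.
  have Q : s d * (p d.+1 + x * q d.+1) = d.+2%:R * q d.+2 + e d * q d.
    by rewrite qS subrK.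
  transitivity (p d.+2 * (s d * (p d.+1 + x * q d.+1)) - q d.+2 * (s d * (x * p d.+1))).
    by rewrite /U; ring.
  by rewrite P Q /w; ring.
rewrite -(pmulr_rgt0 _ (ltr0Sn _ d.+3)) E4 pmulr_rgt0//.
rewrite -(pmulr_rgt0 _ (ltr0Sn _ d.+2)) E3 -(pmulr_rgt0 _ (s0 d)).
rewrite mulrBr [s d * (e _ * _)]mulrCA E2 mulrN opprK ltr_wpDl//.
  rewrite mulr_ge0 ?(ltW (s0 _))// mulr_ge0 ?sqr_ge0//.
  by rewrite !mulr_ge0 ?(ltW x0) ?(ltW (s0 _)).
by rewrite !mulr_gt0.
Qed.

(** The boundary term in Lagrange's identity for the Sturm-Liouville operator
    of the associated Legendre equation. *)
Definition legendre_primitive m d : {poly R} :=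
  (1 - 'X ^+ 2) ^+ m.+1 * legendre_wronskian m d.

(** The factor 4(m+d)+6 is the difference of the eigenvalues (N+2)(N+3) and
    N(N+1) for N = m+d. *)
Lemma deriv_legendre_primitive m d :
  (legendre_primitive m d)^`() = - ((4 * (m + d) + 6)%:R *
    ((1 - 'X ^+ 2) ^+ m * ('L_((m + d)%N, m) * 'L_((m + d).+2, m)))).
Proof.
have O1 := dlegendre_ode (m + d) m; have O2 := dlegendre_ode (m + d).+2 m.
rewrite /legendre_primitive /legendre_wronskian.
rewrite !(derivM, deriv_exp, derivB, derivXn, deriv_dlegendre) /= (derivC 1).
move: O1 O2; set p0 := 'L_(_, m); set p1 := 'L_(_, m.+1); set p2 := 'L_(_, m.+2).
set q0 := 'L_(_, m); set q1 := 'L_(_, m.+1); set q2 := 'L_(_, m.+2) => O1 O2.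
transitivity ((1 - 'X ^+ 2) ^+ m * (p0 * ((1 - 'X ^+ 2) * q2 - 2%:R * m.+1%:R * ('X * q1))
  - q0 * ((1 - 'X ^+ 2) * p2 - 2%:R * m.+1%:R * ('X * p1)))).
  by rewrite !derivX (exprS (1 - 'X^2) m); ring.
move/eqP: O1; rewrite addr_eq0 => /eqP ->; move/eqP: O2; rewrite addr_eq0 => /eqP ->.
by ring.
Qed.

End Legendre.

(** * Integration over a spherical cap region *)

Section Cap.
Context {R : realType}.
Notation mu := (@lebesgue_measure R).
Implicit Types (b f g u : R -> R).

Definition cap b : set (R * R) :=
  [set p | 0 <= p.1 < 2 * pi /\ 0 <= p.2 <= b p.1].

Let T2 := (measurableTypeR R * measurableTypeR R)%type.

Let mcont f : continuous f -> measurable_fun setT (f : measurableTypeR R -> R).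
Proof. exact: continuous_measurable_fun. Qed.

Lemma measurable_cap b : continuous b -> measurable (cap b : set T2).
Proof.
move=> cb.
have -> : cap b = ((fst : T2 -> R) @^-1` `[0, 2 * pi[) `&` (((snd : T2 -> R) @^-1` `[0, +oo[)
    `&` ((fun p : T2 => p.2 - b p.1) @^-1` `]-oo, 0])).
  apply/seteqP; split=> [p [p1 /andP[p2 p3]]|p []]; rewrite /= !in_itv/=.
    by rewrite p1 p2 subr_le0.
  by rewrite andbT => p1 [p2]; rewrite subr_le0 => p3; split=> //; rewrite p2.
apply: measurableI; last apply: measurableI.
- rewrite -[X in measurable X]setTI; exact: measurable_fst.
- rewrite -[X in measurable X]setTI; exact: measurable_snd.
rewrite -[X in measurable X]setTI; apply: measurable_funB => //.
by apply: measurableT_comp; [exact: mcont|exact: measurable_fst].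
Qed.

Lemma cap_integrable b u g (M : R) : continuous b -> (forall x, b x <= M) ->
  continuous u -> continuous g ->
  (@leb2 R).-integrable (cap b) (EFin \o (fun p : R * R => u p.1 * g p.2)).
Proof.
move=> cb bM cu cg; apply: measurable_bounded_integrable.
- exact: measurable_cap.
- apply: (@le_lt_trans _ _ (@leb2 R (`[0, 2 * pi] `*` `[0, M]))).
    apply: le_measure; rewrite ?inE; [exact: measurable_cap|exact: measurableX|].
    move=> p [/andP[p1 /ltW p2] /andP[p3 p4]]; split; rewrite /= in_itv/= ?p1// p3/=.
    exact: le_trans p4 (bM _).
  have fin_itv (c d : R) : (mu `[c, d] < +oo)%E.
    by rewrite (lebesgue_measure_itv `[c, d]) /=; case: ifP => _; rewrite ltry.
  have -> : @leb2 R (`[0, 2 * pi] `*` `[0, M]) = (mu `[0%R, (2 * pi)%R] * mu `[0%R, M])%E.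
    exact: product_measure1E.
  rewrite lte_mul_pinfty//.
  by rewrite ge0_fin_numE.
- apply: measurable_funTS; apply: measurable_funM.
    by apply: measurableT_comp; [exact: mcont|exact: measurable_fst].
  by apply: measurableT_comp; [exact: mcont|exact: measurable_snd].
have [U U0 Ub] := continuous_bounded_itv 0 (2 * pi) cu.
have [V V0 Vb] := continuous_bounded_itv 0 M cg.
exists (U * V); split; first exact: num_real.
move=> B UVB p [/andP[p1 /ltW p2] /andP[p3 p4]]; rewrite /= (le_trans _ (ltW UVB))//.
rewrite normrM ler_pM ?Ub ?Vb ?p1 ?p3//=.
exact: le_trans p4 (bM _).
Qed.

Lemma cap_integral b u g G (M : R) : continuous b -> (forall x, 0 <= b x <= M) ->
  continuous u -> continuous g ->
  (forall x : R, is_derive x 1 G (g x)) -> G 0 = 0 ->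
  \int[@leb2 R]_(p in cap b) (u p.1 * g p.2) =
  \int[mu]_(x in `[0, 2 * pi]) (u x * G (b x)).
Proof.
move=> cb bM cu cg dG G0.
have cG : continuous G := is_derive_continuous dG.
pose F (p : R * R) := u p.1 * g p.2.
have iF : (@leb2 R).-integrable setT (EFin \o (F \_ (cap b))).
  rewrite -restrict_EFin; apply/(integrable_mkcond _ (measurable_cap cb)).
  by apply: (@cap_integrable _ _ _ M) => // x; case/andP: (bM x).
have cuG : continuous (fun x : R => u x * G (b x)).
  by move=> x; apply: cvgM; [exact: cu|exact: (@cvg_comp _ _ _ b G _ _ _ (cb x) (cG _))].
rewrite -Rintegral_itv_bndo_bndc; last first.
  have := continuous_integrable_itv 0 (2 * pi) cuG; apply: integrableS => //.
  by move=> x /=; rewrite !in_itv/= => /andP[-> /ltW].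
rewrite /Rintegral; congr fine.
rewrite [LHS]integral_mkcond restrict_EFin -(integral12_prod_meas1 iF) /fubini_F.
rewrite [RHS]integral_mkcond restrict_EFin; apply: eq_integral => x _ /=.
rewrite patchE; case: ifPn => [|xI].
  rewrite inE /= in_itv /= => xI.
  have -> : (u x * G (b x))%:E = (\int[mu]_(y in `[0%R, b x]) (u x * g y)%:E)%E.
    have [b0 _] := andP (bM x).
    have c1 : continuous (fun y : R => u x * g y).
      by move=> y; apply: cvgM; [exact: cvg_cst|exact: cg].
    have := Rintegral_FTC2 b0 c1 (fun y => is_derive_scale (u x) (dG y)).
    rewrite G0 mulr0 subr0 => <-; rewrite fineK//.
    by apply: integrable_fin_num => //; exact: continuous_integrable_itv.
  rewrite [RHS]integral_mkcond restrict_EFin; apply: eq_integral => y _ /=.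
  rewrite !patchE; suff -> : ((x, y) \in cap b) = (y \in `[0, b x]%classic) by [].
  by apply/idP/idP; rewrite !inE /= in_itv /=; [case|split].
transitivity (\int[mu]_y (0 : \bar R))%E; last by rewrite integral0.
apply: eq_integral => y _ /=; rewrite patchE ifN//.
by apply: contra xI; rewrite !inE /= in_itv /=; case=> /andP[-> ->].
Qed.

End Cap.

(** * Cones in polar coordinates *)

Section PolarCone.
Context {R : realType}.
Implicit Types (b f : R -> R) (phi theta t : R).

Lemma continuous_pair (T U V : topologicalType) (f : T -> U) (g : T -> V) :
  continuous f -> continuous g -> continuous (fun x => (f x, g x)).
Proof.
move=> cf cg x.
exact: (@cvg_pair _ _ _ _ (nbhs (f x)) (nbhs (g x)) _ _ _ f g (cf x) (cg x)).
Qed.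

Definition clamp (c d x : R) : R := Num.max c (Num.min x d).

Lemma clamp_itv (c d x : R) : c <= d -> c <= clamp c d x <= d.
Proof. by move=> cd; rewrite /clamp le_max lexx/= ge_max cd ge_min lexx orbT. Qed.

Lemma clamp_id (c d x : R) : c <= x <= d -> clamp c d x = x.
Proof. by move=> /andP[cx xd]; rewrite /clamp min_l// max_r. Qed.

(** Precomposing with the projection onto [c, d] extends a function that is
    continuous on [c, d] to the whole line. *)
Lemma continuous_clamp_comp f (c d : R) : c <= d ->
  {within `[c, d], continuous f} -> continuous (fun x => f (clamp c d x)).
Proof.
move=> cd /subspace_continuousP cf x.
have Ax : (`[c, d]%classic : set R) (clamp c d x) by rewrite /= in_itv /= clamp_itv.
apply: (cvg_comp _ _ _ (cf _ Ax)) => U /= [e /= e0 eU].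
have cc : {for x, continuous (clamp c d)}.
  apply: (@continuous_max R _ (fun=> c) (fun x => Num.min x d)); first exact: cvg_cst.
  by apply: (@continuous_min R _ id (fun=> d)); [exact: cvg_id|exact: cvg_cst].
have /nbhs_ballP[r /= r0 rx] := cc _ (nbhsx_ballx (clamp c d x) e e0).
apply/nbhs_ballP; exists r => //= y xy; apply: eU; first exact: rx.
by rewrite /= in_itv /= clamp_itv.
Qed.

Lemma dot3E (x y : 'rV[R]_3) : dot3 x y =
  x 0 0 * y 0 0 + (x 0 (inord 1) * y 0 (inord 1) + x 0 (inord 2) * y 0 (inord 2)).
Proof.
rewrite /dot3 !big_ord_recl big_ord0 addr0.
by do ! [congr (_ + _)]; congr (x _ _ * y _ _); apply/val_inj; rewrite /= inordK.
Qed.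

Lemma vec3E (a c d : R) : ((vec3 a c d 0 0 = a) * (vec3 a c d 0 (inord 1) = c) *
  (vec3 a c d 0 (inord 2) = d))%type.
Proof. by rewrite !mxE /= !inordK. Qed.

Lemma dot3_sph_point phi theta : dot3 (sph_point phi theta) (sph_point phi theta) = 1.
Proof.
rewrite dot3E /sph_point !vec3E -!expr2 !exprMn addrA -mulrDr cos2Dsin2 mulr1.
by rewrite addrC cos2Dsin2.
Qed.

Lemma cos_eq1 (x : R) : `|x| < 2 * pi -> cos x = 1 -> x = 0.
Proof.
wlog x0 : x / 0 <= x => [H xpi cx|].
  have [x0|/ltW x0] := leP 0 x; first exact: H.
  by apply/eqP; rewrite -oppr_eq0; apply/eqP/H; rewrite ?oppr_ge0 ?normrN ?cosN.
rewrite ger0_norm// => xpi cx; apply/eqP/negPn/negP => xn0.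
have : 0 < sin (x / 2).
  apply: sin_gt0_pi; apply/andP; split; last by rewrite ltr_pdivrMr// mulrC.
  by rewrite divr_gt0// lt_neqAle eq_sym xn0.
suff -> : sin (x / 2) = 0 by rewrite ltxx.
have : cos (x / 2 + x / 2) = 1 by rewrite -splitr.
rewrite cosD -!expr2 cos2sin2 => E; apply/eqP; rewrite -sqrf_eq0; apply/eqP; lra.
Qed.

Lemma cos_sin_inj phi phi' : 0 <= phi < 2 * pi -> 0 <= phi' < 2 * pi ->
  cos phi = cos phi' -> sin phi = sin phi' -> phi = phi'.
Proof.
move=> /andP[p1 p2] /andP[q1 q2] cE sE; apply/eqP; rewrite -subr_eq0; apply/eqP.
apply: cos_eq1; first by rewrite ltr_norml; apply/andP; split; lra.
by rewrite cosB cE sE -!expr2 cos2Dsin2.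
Qed.

Definition polar_cone b : set 'rV[R]_3 :=
  [set x | exists t phi theta, [/\ 0 <= t, 0 <= phi < 2 * pi,
     0 <= theta <= b phi & x = t *: sph_point phi theta]].

(** Polar coordinates are injective away from the poles; the north pole lies in
    the cone for every value of phi, and the south pole does not because the
    opening angle is less than pi/2. *)
Lemma polar_cone_region b : (forall phi, 0 <= b phi < pi / 2) ->
  [set p : R * R | [/\ 0 <= p.1 < 2 * pi, 0 <= p.2 <= pi &
     (polar_cone b `&` sphere) (sph_point p.1 p.2)]] = cap b.
Proof.
move=> bpi; have pi0 : 0 < pi :> R := pi_gt0 R.
apply/seteqP; split=> [[phi theta] /= [pI tI [[t [phi' [theta' [t0 p'I t'I E]]]] _]]|].
  split=> //=; have [b0 bphi] := andP (bpi phi'); have [t'0 t'b] := andP t'I.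
  have t1 : t = 1.
    have := dot3_sph_point phi theta; rewrite [in LHS]E dot3E !mxE.
    rewrite (_ : _ + _ = t ^+ 2 * dot3 (sph_point phi' theta') (sph_point phi' theta')).
      by rewrite dot3_sph_point mulr1 => /eqP; rewrite sqrp_eq1// => /eqP.
    by rewrite dot3E !mxE /= ; ring.
  move: E; rewrite t1 scale1r => E.
  have E0 := congr1 (fun x : 'rV_3 => x 0 0) E.
  have E1 := congr1 (fun x : 'rV_3 => x 0 (inord 1)) E.
  have E2 := congr1 (fun x : 'rV_3 => x 0 (inord 2)) E.
  rewrite /sph_point !vec3E in E0 E1 E2.
  have tt : theta = theta'.
    apply: cos_inj => //; rewrite in_itv/= t'0 /=.
    by rewrite (le_trans t'b)// ltW// (lt_trans bphi)// ltr_pdivrMr// ltr_pMr// ltr1n.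
  subst theta'; rewrite t'0 /=.
  have [->|tn0] := eqVneq theta 0; first by case/andP: (bpi phi).
  have s0 : sin theta != 0.
    rewrite gt_eqF// sin_gt0_pi// lt_neqAle eq_sym tn0 t'0/=.
    by rewrite (le_lt_trans t'b)// (lt_trans bphi)// ltr_pdivrMr// ltr_pMr// ltr1n.
  rewrite (_ : phi = phi')//; apply: cos_sin_inj => //; exact: (mulfI s0).
move=> [phi theta] [/= pI /andP[t0 tb]]; split=> //=.
  rewrite t0 (le_trans tb)//; have [_ /ltW bphi] := andP (bpi phi).
  by rewrite (le_trans bphi)// ler_pdivrMr// ler_pMr// ler1n.
split; last exact: dot3_sph_point.
by exists 1, phi, theta; rewrite scale1r t0.
Qed.

Lemma polar_coneZ b (t : R) x : 0 <= t -> polar_cone b x -> polar_cone b (t *: x).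
Proof.
move=> t0 [s [phi [theta [s0 pI tI ->]]]]; exists (t * s), phi, theta.
by rewrite scalerA mulr_ge0.
Qed.

(** Near a given point the cone coincides with its part of length at most M,
    and that part is the continuous image of the compact box
    [0, M] x [0, 2 pi] x [0, 1] under (t, phi, s) |-> t * (point of polar angle
    s b(phi)).  The value phi = 2 pi adds no point since b 0 = b (2 pi).
    The argument takes place in R * R * R, which receives the cone through the
    continuous injection of coordinates. *)
Lemma closed_polar_cone b : continuous b -> (forall x, 0 <= b x) ->
  b 0 = b (2 * pi) -> closed (polar_cone b).
Proof.
move=> cb b0 b2pi; have pi0 : 0 < 2 * pi :> R by rewrite mulr_gt0// pi_gt0.
pose psi (p : R * R * R) : R * R * R := let: (t, phi, s) := p in
  (t * (sin (s * b phi) * cos phi), t * (sin (s * b phi) * sin phi),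
   t * cos (s * b phi)).
pose tri (x : 'rV[R]_3) : R * R * R := (x 0 0, x 0 (inord 1), x 0 (inord 2)).
have ctri : continuous tri.
  by apply: continuous_pair; [apply: continuous_pair|]; exact: coord_continuous.
have tri_inj : injective tri.
  move=> x y [E0 E1 E2]; apply/rowP => i; case: i => [[|[|[|//]]] il].
  - by rewrite (_ : Ordinal il = 0)//; exact/val_inj.
  - by rewrite (_ : Ordinal il = inord 1)//; apply/val_inj; rewrite /= inordK.
  - by rewrite (_ : Ordinal il = inord 2)//; apply/val_inj; rewrite /= inordK.
have cpsi : continuous psi.
  have c1 : continuous (fun p : R * R * R => p.1.1).
    by move=> p; exact: (cvg_comp _ _ cvg_fst cvg_fst).
  have c2 : continuous (fun p : R * R * R => p.1.2).
    by move=> p; exact: (cvg_comp _ _ cvg_fst cvg_snd).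
  have c3 : continuous (fun p : R * R * R => p.2 * b p.1.2).
    by move=> p; apply: cvgM; [exact: cvg_snd|exact: (cvg_comp _ _ (c2 p) (cb _))].
  have cs f g : continuous f -> continuous g -> continuous (fun p : R * R * R => f (g p)).
    by move=> cf cg p; exact: (cvg_comp _ _ (cg p) (cf _)).
  have -> : psi = (fun p => (p.1.1 * (sin (p.2 * b p.1.2) * cos p.1.2),
     p.1.1 * (sin (p.2 * b p.1.2) * sin p.1.2), p.1.1 * cos (p.2 * b p.1.2))).
    by apply/funext => -[[? ?] ?].
  apply: continuous_pair; first apply: continuous_pair; move=> p.
  - apply: cvgM; first exact: c1.
    by apply: cvgM; apply: cs => //; [exact: continuous_sin|exact: continuous_cos].
  - apply: cvgM; first exact: c1.
    by apply: cvgM; apply: cs => //; exact: continuous_sin.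
  - by apply: cvgM; [exact: c1|apply: cs => //; exact: continuous_cos].
pose q (p : R * R * R) := p.1.1 ^+ 2 + p.1.2 ^+ 2 + p.2 ^+ 2.
have cq : continuous q.
  have sq (h : R * R * R -> R) : continuous h -> continuous (fun p => h p ^+ 2).
    by move=> ch p; exact: (cvg_comp _ _ (ch p) (@exprn_continuous _ 2 _)).
  move=> p; apply: cvgD; first apply: cvgD; apply: sq => p'.
  - exact: (cvg_comp _ _ cvg_fst cvg_fst).
  - exact: (cvg_comp _ _ cvg_fst cvg_snd).
  - exact: cvg_snd.
have qpsi t phi s : q (psi (t, phi, s)) = t ^+ 2.
  transitivity (t ^+ 2 * (cos (s * b phi) ^+ 2 +
    sin (s * b phi) ^+ 2 * (cos phi ^+ 2 + sin phi ^+ 2))).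
    by rewrite /q /=; ring.
  by rewrite cos2Dsin2 mulr1 cos2Dsin2 mulr1.
have tripsi t phi theta s : theta = s * b phi ->
    tri (t *: sph_point phi theta) = psi (t, phi, s).
  by move=> ->; rewrite /tri !mxE /= !inordK.
pose box (M : R) : set (R * R * R) := `[0, M] `*` `[0, 2 * pi] `*` `[0, 1].
have box_cone M p : box M p -> exists2 x, polar_cone b x & tri x = psi p.
  case: p => -[t phi] s [[]] /=; rewrite !in_itv /= => /andP[t0 _] /andP[p0 p1] /andP[s0 s1].
  have [p2|p2] := ltP phi (2 * pi).
    exists (t *: sph_point phi (s * b phi)); last exact: tripsi.
    exists t, phi, (s * b phi); rewrite t0 p0 p2 mulr_ge0// ler_piMl//.
  have -> : phi = 2 * pi by apply/eqP; rewrite eq_le p1 p2.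
  exists (t *: sph_point 0 (s * b 0)).
    by exists t, 0, (s * b 0); rewrite t0 lexx pi0 mulr_ge0// ler_piMl.
  rewrite (tripsi _ _ _ s)// /psi b2pi mulr_natl cos2pi sin2pi cos0 sin0.
  by [].
have cone_box x M : 0 <= M -> polar_cone b x -> q (tri x) < M ^+ 2 ->
    exists2 p, box M p & psi p = tri x.
  move=> M0 [t [phi [theta [t0 /andP[p0 /ltW p1] /andP[th0 th1] ->]]]].
  have [s s01 sE] : exists2 s, 0 <= s <= 1 & theta = s * b phi.
    have [bp|bp] := eqVneq (b phi) 0.
      by exists 0; rewrite ?lexx ?ler01// mul0r; apply/eqP; rewrite eq_le th0 -bp th1.
    have bp0 : 0 < b phi by rewrite lt_neqAle eq_sym bp b0.
    by exists (theta / b phi); rewrite ?divr_ge0 ?ler_pdivrMr ?mul1r ?divfK.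
  rewrite (tripsi _ _ _ s)// qpsi => tM; exists (t, phi, s) => //.
  split; [split|]; rewrite /= in_itv/= ?p0// t0 /= ltW//.
  by rewrite -(@ltr_pXn2r _ 2).
rewrite (_ : polar_cone b = tri @^-1` (tri @` polar_cone b)); last first.
  by apply/seteqP; split=> [x Cx|x [y Cy /tri_inj <-]//]; exists x.
apply: closed_comp; first by move=> x _; exact: ctri.
move=> p clp.
pose M := q p + 1.
have q0 : 0 <= q p by rewrite !addr_ge0 ?sqr_ge0.
have pM : q p < M ^+ 2 by rewrite /M; nra.
have Kp : closure (psi @` box M) p.
  move=> U Up.
  have nq : nbhs p [set z | q z < M ^+ 2] by exact: (cvgr_lt (q p) (cq p) _ pM).
  have [_ [[x Cx <-] [Ux qx]]] := clp _ (filterI Up nq).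
  have M0 : 0 <= M by rewrite addr_ge0.
  by have [z bz zx] := cone_box x M M0 Cx qx; exists (tri x); split=> //; exists z.
have cK : compact (psi @` box M).
  apply: continuous_compact; first exact: (continuous_subspaceT cpsi).
  by do 2 ? apply: compact_setX; exact: segment_compact.
have /closure_id clK := compact_closed (@norm_hausdorff _ _) cK.
move: Kp; rewrite -clK => -[z /box_cone[x Cx xz] zp].
by exists x => //; rewrite xz.
Qed.

End PolarCone.

(** * Linearity of complex-valued integrals *)

Section ComplexIntegral.
Context {R : realType} {d : measure_display} {T : measurableType d}.
Variables (mu : {measure set T -> \bar R}) (A : set T).
Hypothesis mA : measurable A.
Local Open Scope complex_scope.
Implicit Types (f g : T -> R[i]).

Definition cintegrable f : Prop :=
  mu.-integrable A (EFin \o (fun x => complex.Re (f x))) /\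
  mu.-integrable A (EFin \o (fun x => complex.Im (f x))).

Let realZ (e : R) (h : T -> R) : mu.-integrable A (EFin \o h) ->
  mu.-integrable A (EFin \o (fun x => e * h x)).
Proof. exact: (integrableZl mA e). Qed.

Let realD (g h : T -> R) : mu.-integrable A (EFin \o g) ->
  mu.-integrable A (EFin \o h) -> mu.-integrable A (EFin \o (fun x => g x + h x)).
Proof. exact: (integrableD mA). Qed.

Lemma eq_cintegral f g : (forall x, A x -> f x = g x) ->
  cintegral mu A f = cintegral mu A g.
Proof.
by move=> fg; congr (_ +i* _); apply: eq_Rintegral => x; rewrite inE => /fg ->.
Qed.

Lemma eq_cintegrable f g : (forall x, A x -> f x = g x) ->
  cintegrable f -> cintegrable g.
Proof.
move=> fg [rf jf]; split.
  by apply: eq_integrable rf => // x; rewrite inE => /fg /= ->.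
by apply: eq_integrable jf => // x; rewrite inE => /fg /= ->.
Qed.

Lemma cintegrableZ (c : R[i]) f : cintegrable f -> cintegrable (fun x => c * f x).
Proof.
case: c => a b [rf jf].
split.
  rewrite (_ : (fun x => _) = fun x => a * complex.Re (f x) + - b * complex.Im (f x)).
    by apply: realD; exact: realZ.
  by apply/funext => x; case: (f x) => ? ? /=; rewrite mulNr.
rewrite (_ : (fun x => _) = fun x => a * complex.Im (f x) + b * complex.Re (f x)).
  by apply: realD; exact: realZ.
by apply/funext => x; case: (f x).
Qed.

Lemma cintegrableD f g : cintegrable f -> cintegrable g ->
  cintegrable (fun x => f x + g x).
Proof.
move=> [rf jf] [rg jg]; split.
  under eq_fun do rewrite raddfD; exact: realD.
under eq_fun do rewrite raddfD; exact: realD.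
Qed.

Lemma cintegralD f g : cintegrable f -> cintegrable g ->
  cintegral mu A (fun x => f x + g x) = cintegral mu A f + cintegral mu A g.
Proof.
move=> [rf jf] [rg jg]; rewrite /cintegral; simpc; rewrite -!RintegralD//.
by congr (_ +i* _); apply: eq_Rintegral => x _; rewrite raddfD.
Qed.

Lemma cintegralZ (c : R[i]) f : cintegrable f ->
  cintegral mu A (fun x => c * f x) = c * cintegral mu A f.
Proof.
case: c => a b [rf jf]; rewrite /cintegral; simpc.
rewrite -!RintegralZl// -RintegralB ?realZ// -RintegralD ?realZ//.
by congr (_ +i* _); apply: eq_Rintegral => x _; case: (f x).
Qed.

Lemma cintegral_sum n (c : 'I_n -> R[i]) (f : 'I_n -> T -> R[i]) :
  (forall i, cintegrable (f i)) ->
  cintegral mu A (fun x => \sum_i c i * f i x) = \sum_i c i * cintegral mu A (f i).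
Proof.
move=> fi.
suff [] : cintegrable (fun x => \sum_i c i * f i x) /\
  cintegral mu A (fun x => \sum_i c i * f i x) = \sum_i c i * cintegral mu A (f i) by [].
elim: (index_enum _) => [|i s [ih1 ih2]].
  split; first by split; under eq_fun do rewrite big_nil; exact: integrable0.
  rewrite big_nil /cintegral; under eq_Rintegral do rewrite big_nil /=.
  under [X in _ +i* X]eq_Rintegral do rewrite big_nil /=.
  by rewrite Rintegral_cst// mul0r.
split.
  apply: (eq_cintegrable (f := fun x => c i * f i x + \sum_(j <- s) c j * f j x)).
    by move=> x _; rewrite big_cons.
  by apply: cintegrableD => //; exact: cintegrableZ.
rewrite big_cons -ih2 -cintegralZ// -cintegralD//; last exact: cintegrableZ.
by apply: eq_cintegral => x _; rewrite big_cons.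
Qed.

End ComplexIntegral.

(** * Spherical harmonics in polar coordinates *)

Section Angular.
Context {R : realType}.
Local Open Scope complex_scope.
Notation mu := (@lebesgue_measure R).
Local Notation "'L_ ( n , m )" := (@dlegendre R n m) (at level 0).

Lemma conj_real_expi (a x : R) : ((a%:C * expi x)^*)%C = a%:C * expi (- x).
Proof. by rewrite /expi sinN cosN; simpc. Qed.

Lemma mul_real_expi (a c e x y : R) : a%:C * expi x * (c%:C * expi y) * e%:C =
  (cos (x + y) * (a * c * e)) +i* (sin (x + y) * (a * c * e)).
Proof. by rewrite /expi sinD cosD; simpc; congr (_ +i* _); ring. Qed.

(** The ratio of Y_N^k to (sin theta)^|k| P_N^(|k|)(cos theta) e^{ik phi}; the
    conditional factor comes from the definition of P_N^{-m}. *)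
Definition sph_const N (k : int) : R :=
  (-1) ^ k * Num.sqrt ((N.*2.+1)%:R / (4 * pi) *
     ((absz (N%:Z - k)%R)`!%:R / (absz (N%:Z + k)%R)`!%:R)) *
  (if k is Negz n then (-1) ^+ n.+1 * ((N - n.+1)`!%:R / (N + n.+1)`!%:R) else 1) *
  (-1) ^+ absz k.

Lemma sph_const_neq0 N k : sph_const N k != 0.
Proof.
have f0 n : 0 < n`!%:R :> R by rewrite ltr0n fact_gt0.
rewrite /sph_const !mulf_neq0 ?expfz_neq0 ?expf_neq0 ?oppr_eq0 ?oner_neq0//.
  by rewrite sqrtr_eq0 -ltNge !mulr_gt0 ?invr_gt0 ?mulr_gt0// pi_gt0.
case: k => n; rewrite ?oner_neq0//.
by rewrite !mulf_neq0 ?expf_neq0 ?oppr_eq0 ?oner_neq0 ?invr_eq0 ?gt_eqF.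
Qed.

Lemma sphYE N (k : int) (phi theta : R) : sphY N k phi theta =
  (sph_const N k * (Num.sqrt (1 - cos theta ^+ 2) ^+ absz k *
    'L_(N, absz k).[cos theta]))%:C * expi (k%:~R * phi).
Proof.
rewrite /sphY mulrAC -rmorphM /=; congr (_%:C * _).
rewrite /sph_const /legendre_assoc /legendre_assoc_nat; case: k => n.
  by rewrite dlegendreE mulr1 /=; ring.
by rewrite dlegendreE /=; ring.
Qed.

Lemma sqrt_1Bcos2 (theta : R) : 0 <= theta <= pi ->
  Num.sqrt (1 - cos theta ^+ 2) = sin theta.
Proof.
by move=> /sin_ge0_pi s0; rewrite -sin2cos2 sqrtr_sqr ger0_norm.
Qed.

(** The theta-factor of Y_{N+2}^k times the conjugate of Y_N^l, including the
    density sin theta of the surface measure. *)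
Definition polar_density N (k l : int) (theta : R) : R :=
  sph_const (N + 2) k * sph_const N l *
  (sin theta ^+ (absz k + absz l).+1 *
   ('L_((N + 2)%N, absz k).[cos theta] * 'L_(N, absz l).[cos theta])).

Lemma exp_type_polar_density N k l : exp_type (polar_density N k l).
Proof.
have [ec es] := @exp_type_cos_sin R.
apply: exp_type_scale; apply: exp_typeM; first exact: exp_typeX.
by apply: exp_typeM; exact: exp_type_horner.
Qed.

Lemma integrand_polar N k l (phi theta : R) : 0 <= theta <= pi ->
  sphY (N + 2) k phi theta * ((sphY N l phi theta)^*)%C * (sin theta)%:C =
  (cos ((k - l)%:~R * phi) * polar_density N k l theta) +i*
  (sin ((k - l)%:~R * phi) * polar_density N k l theta).
Proof.
move=> tpi; rewrite !sphYE !sqrt_1Bcos2//.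
rewrite conj_real_expi mul_real_expi -mulrBl -rmorphB /=.
set c := _ * _ * sin theta; suff -> : c = polar_density N k l theta by [].
by rewrite /c /polar_density exprS exprD; ring.
Qed.

End Angular.

(** * The integrals of the star-shaped deformation *)

Lemma cos_sin_int2pi (R : realType) (z : int) :
  cos (2 * pi * z%:~R) = 1 :> R /\ sin (2 * pi * z%:~R) = 0 :> R.
Proof.
have H (n : nat) : cos (2 * pi * n%:R) = 1 :> R /\ sin (2 * pi * n%:R) = 0 :> R.
  elim: n => [|n [ihc ihs]]; first by rewrite mulr0 cos0 sin0.
  rewrite -(natr1 n) mulrDr mulr1 cosD sinD ihc ihs mulr_natl cos2pi sin2pi.
  by rewrite !mul0r !mulr0 addr0 subr0 mulr1.
case: z => n; first exact: H.
rewrite NegzE rmorphN /= mulrN cosN sinN; have [-> ->] := H n.+1.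
by rewrite oppr0.
Qed.

Section StarIntegrals.
Context {R : realType}.
Variables (rho0 : R) (sigma : R -> R) (eps : R).
Hypothesis hdef : star_deformation rho0 sigma eps.
Local Open Scope complex_scope.
Notation mu := (@lebesgue_measure R).
Local Notation "'L_ ( n , m )" := (@dlegendre R n m) (at level 0).

(** Clamping phi to [0, 2 pi] makes the profile a continuous function on the
    whole line. *)
Definition excess (phi : R) : R := sigma (clamp 0 (2 * pi) phi) - rho0.
Definition profile (rho phi : R) : R := rho * excess phi + rho0.

Let pi2_gt0 : 0 < 2 * pi :> R.
Proof. by rewrite mulr_gt0// pi_gt0. Qed.

Lemma continuous_excess : continuous excess.
Proof.
have [_ cs _ _ _] := hdef; move=> x; apply: cvgB; last exact: cvg_cst.
exact: (continuous_clamp_comp (ltW pi2_gt0) cs).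
Qed.

Lemma continuous_profile rho : continuous (profile rho).
Proof.
move=> x; apply: cvgD; last exact: cvg_cst.
by apply: cvgM; [exact: cvg_cst|exact: continuous_excess].
Qed.

(** The angle is affine in rho, and the bounds hold at both ends - eps and 1. *)
Lemma profile_itv (rho phi : R) : - eps < rho < 1 -> 0 < profile rho phi < pi / 2.
Proof.
have [/andP[r0 rpi] _ _ sb [e0 [r' /andP[r'0 _] rb]]] := hdef.
move=> /andP[rho_ge rho_lt].
have pI : 0 <= clamp 0 (2 * pi) phi <= 2 * pi by exact/clamp_itv/ltW.
rewrite /profile /excess; have /andP[s1 s2] := sb _ pI; have /andP[b1 b2] := rb _ pI.
set s := sigma _ in s1 s2 b1 b2 *.
apply/andP; split; nra.
Qed.

Lemma profile_2pi rho : profile rho 0 = profile rho (2 * pi).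
Proof.
have [_ _ s2pi _ _] := hdef; rewrite /profile /excess !clamp_id ?s2pi//.
  by rewrite lexx ltW.
by rewrite lexx ltW.
Qed.

Lemma star_cone_polar rho :
  star_cone rho0 sigma rho = polar_cone (profile rho).
Proof.
have E phi : 0 <= phi < 2 * pi ->
    profile rho phi = rho * sigma phi + (1 - rho) * rho0.
  move=> /andP[p0 p1]; rewrite /profile /excess clamp_id; first by ring.
  by rewrite p0 ltW.
apply/seteqP; split=> x [t [phi [theta [t0 pI tI ->]]]]; exists t, phi, theta.
  by rewrite E.
by rewrite -E.
Qed.

(** The Fourier coefficient of order - z, up to a factor 2 pi, of G composed
    with the opening angle. *)
Definition profile_fourier (G : R -> R) (z : int) (rho : R) : R[i] :=
  (\int[mu]_(phi in `[0, 2 * pi]) (cos (z%:~R * phi) * G (profile rho phi))) +i*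
  (\int[mu]_(phi in `[0, 2 * pi]) (sin (z%:~R * phi) * G (profile rho phi))).

Let continuous_cosz (z : int) : continuous (fun phi : R => cos (z%:~R * phi)).
Proof.
move=> x; apply: (@cvg_comp _ _ _ (fun phi : R => z%:~R * phi) cos).
  by apply: cvgM; [exact: cvg_cst|exact: cvg_id].
exact: continuous_cos.
Qed.

Let continuous_sinz (z : int) : continuous (fun phi : R => sin (z%:~R * phi)).
Proof.
move=> x; apply: (@cvg_comp _ _ _ (fun phi : R => z%:~R * phi) sin).
  by apply: cvgM; [exact: cvg_cst|exact: cvg_id].
exact: continuous_sin.
Qed.

Lemma cexp_type_profile_fourier G z : exp_type G -> cexp_type (profile_fourier G z).
Proof.
move=> eG; split; apply: exp_type_integral => //; first exact: ltW.
- exact: continuous_excess.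
- exact: ltW.
- exact: continuous_excess.
Qed.

Lemma profile_fourier_offdiag0 G z : z != 0 -> profile_fourier G z 0 = 0.
Proof.
move=> z0; have zR : z%:~R != 0 :> R by rewrite intr_eq0.
have [c2 s2] := cos_sin_int2pi R z.
have [ec es] := @exp_type_cos_sin R.
have prof0 phi : profile 0 phi = rho0 by rewrite /profile mul0r add0r.
set c := G rho0.
rewrite /profile_fourier; congr (_ +i* _).
  under eq_Rintegral do rewrite prof0.
  have cf : continuous (fun x : R => cos (z%:~R * x) * c).
    by move=> x; apply: cvgM; [exact: continuous_cosz|exact: cvg_cst].
  have dF (x : R) : is_derive x 1 (fun y => c / z%:~R * sin (y * z%:~R + 0))
      (cos (z%:~R * x) * c).
    have /is_derive_eq := is_derive_scale (c / z%:~R)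
      (is_derive_affine_comp z%:~R 0 x (@is_derive_sin R)).
    by apply; rewrite addr0 (mulrC x); field.
  by rewrite (Rintegral_FTC2 (ltW pi2_gt0) cf dF) !addr0 mul0r sin0 s2 subrr.
under eq_Rintegral do rewrite prof0.
have cf : continuous (fun x : R => sin (z%:~R * x) * c).
  by move=> x; apply: cvgM; [exact: continuous_sinz|exact: cvg_cst].
have dF (x : R) : is_derive x 1 (fun y => - c / z%:~R * cos (y * z%:~R + 0))
    (sin (z%:~R * x) * c).
  have /is_derive_eq := is_derive_scale (- c / z%:~R)
    (is_derive_affine_comp z%:~R 0 x (@is_derive_cos R)).
  by apply; rewrite addr0 (mulrC x); field.
by rewrite (Rintegral_FTC2 (ltW pi2_gt0) cf dF) !addr0 mul0r cos0 c2 subrr.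
Qed.

Lemma profile_fourier_diag0 G : complex.Re (profile_fourier G 0 0) = 2 * pi * G rho0.
Proof.
rewrite /profile_fourier /=.
have prof0 phi : profile 0 phi = rho0 by rewrite /profile mul0r add0r.
under eq_Rintegral do rewrite prof0 mul0r cos0 mul1r.
have cf : continuous (fun _ : R => G rho0) by move=> x; exact: cvg_cst.
have dF (x : R) : is_derive x 1 (fun y => G rho0 * y) (G rho0).
  by have /is_derive_eq := is_derive_scale (G rho0) (is_derive_id x 1); apply; rewrite mulr1.
by rewrite (Rintegral_FTC2 (ltW pi2_gt0) cf dF) mulr0 subr0 mulrC.
Qed.

Lemma star_region (rho : R) : - eps < rho < 1 ->
  [set p : R * R | [/\ 0 <= p.1 < 2 * pi, 0 <= p.2 <= pi &
     (star_cone rho0 sigma rho `&` sphere) (sph_point p.1 p.2)]] = cap (profile rho).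
Proof.
move=> rI; rewrite star_cone_polar polar_cone_region// => phi.
by have /andP[/ltW-> ->] := profile_itv phi rI.
Qed.

Lemma cap_le_pi (rho : R) (p : R * R) : - eps < rho < 1 -> cap (profile rho) p ->
  0 <= p.2 <= pi.
Proof.
move=> rI [_ /andP[-> pb]]; rewrite (le_trans pb)//.
have /andP[_ /ltW bphi] := profile_itv p.1 rI.
by rewrite (le_trans bphi)// ler_pdivrMr ?ler_pMr ?ler1n ?pi_gt0.
Qed.

Lemma cintegrable_integrand N k l (rho : R) : - eps < rho < 1 ->
  cintegrable (@leb2 R) (cap (profile rho)) (fun p : R * R =>
    sphY (N + 2) k p.1 p.2 * ((sphY N l p.1 p.2)^*)%C * (sin p.2)%:C).
Proof.
move=> rI; have mb phi : profile rho phi <= pi / 2.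
  by have /andP[_ /ltW] := profile_itv phi rI.
have cd := exp_type_continuous (@exp_type_polar_density R N k l).
pose f (p : R * R) := (cos ((k - l)%:~R * p.1) * polar_density N k l p.2) +i*
                 (sin ((k - l)%:~R * p.1) * polar_density N k l p.2).
refine (eq_cintegrable (measurable_cap (@continuous_profile rho)) (f := f) _ _).
  by move=> p /(cap_le_pi rI) pI; rewrite integrand_polar.
split.
  exact: (cap_integrable (@continuous_profile rho) mb (@continuous_cosz (k - l)) cd).
exact: (cap_integrable (@continuous_profile rho) mb (@continuous_sinz (k - l)) cd).
Qed.

Lemma star_I_fourier N k l : exists G, [/\ exp_type G, G 0 = 0,
  forall x : R, is_derive x 1 G (polar_density N k l x) &
  forall rho : R, - eps < rho < 1 ->
    star_I rho0 sigma N k l rho = profile_fourier G (k - l) rho].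
Proof.
have ed := @exp_type_polar_density R N k l.
have [G [eG G0 dG]] := exp_type_primitive ed; exists G; split=> // rho rI.
have mb phi : 0 <= profile rho phi <= pi / 2.
  by have /andP[/ltW-> /ltW] := profile_itv phi rI.
rewrite /star_I /sphere_integral star_region//.
pose f (p : R * R) := (cos ((k - l)%:~R * p.1) * polar_density N k l p.2) +i*
                 (sin ((k - l)%:~R * p.1) * polar_density N k l p.2).
transitivity (cintegral (@leb2 R) (cap (profile rho)) f).
  by apply: eq_cintegral => p /(cap_le_pi rI) pI; rewrite integrand_polar.
congr (_ +i* _).
  exact: (cap_integral (@continuous_profile rho) mb (@continuous_cosz (k - l))
    (exp_type_continuous ed) dG G0).
exact: (cap_integral (@continuous_profile rho) mb (@continuous_sinz (k - l))
    (exp_type_continuous ed) dG G0).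
Qed.

(** The substitution x = cos theta turns [legendre_primitive] into an explicit
    primitive of the density, which vanishes at theta = 0. *)
Lemma polar_primitive_neq0 N k G : (absz k <= N)%N -> G 0 = 0 ->
  (forall x : R, is_derive x 1 G (polar_density N k k x)) -> G rho0 != 0.
Proof.
move=> kN G0 dG; have [/andP[r0 rpi] _ _ _ _] := hdef.
set m := absz k in kN; have [d NE] : exists d, N = (m + d)%N.
  by exists (N - m)%N; rewrite subnKC.
pose c := sph_const (N + 2) k * sph_const N k / (4 * (m + d) + 6)%:R : R.
have n0 : (4 * (m + d) + 6)%:R != 0 :> R by rewrite pnatr_eq0 addnS.
have c0 : c != 0.
  by apply: mulf_neq0; [apply: mulf_neq0; exact: sph_const_neq0|rewrite invr_eq0].
pose H x := c * (legendre_primitive m d).[cos x].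
have dH (x : R) : is_derive x 1 H (polar_density N k k x).
  have := is_derive_scale c (@is_derive1_comp _ (horner (legendre_primitive m d)) cos x _ _
    (is_derive_poly _ _) (is_derive_cos x)).
  move/is_derive_eq; apply.
  rewrite deriv_legendre_primitive !(hornerN, hornerM) -polyC_natr hornerC.
  rewrite horner_exp hornerD hornerN hornerXn (hornerC 1) -sin2cos2 /polar_density -/m.
  rewrite (exprS _ (m + m)) addnn -mul2n exprM /c NE addn2.
  by field.
have GH : G rho0 = H rho0 - H 0.
  have cd := exp_type_continuous (@exp_type_polar_density R N k k).
  by rewrite -(Rintegral_FTC2 (ltW r0) cd dH) (Rintegral_FTC2 (ltW r0) cd dG) G0 subr0.
have : 0 < (legendre_wronskian m d).[cos rho0].
  rewrite legendre_wronskian_gt0// cos_gt0_pihalf// rpi andbT.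
  by rewrite (lt_trans _ r0)// oppr_lt0 divr_gt0// pi_gt0.
rewrite GH /H cos0 /legendre_primitive; move: (legendre_wronskian m d) => W W0.
rewrite !hornerM !horner_exp !hornerD !hornerN !hornerXn !(hornerC 1) -sin2cos2.
rewrite expr1n subrr expr0n /= mul0r mulr0 subr0 mulf_neq0// mulf_neq0//.
  rewrite expf_neq0// expf_neq0// gt_eqF// sin_gt0_pi// r0 (lt_trans rpi)//.
  by rewrite ltr_pdivrMr// ltr_pMr ?pi_gt0// ltr1n.
by rewrite gt_eqF.
Qed.

End StarIntegrals.

(** * Determinants, moments and admissibility *)

Section Assembly.
Context {R : realType}.
Variables (rho0 : R) (sigma : R -> R) (eps : R).
Hypothesis hdef : star_deformation rho0 sigma eps.
Local Open Scope complex_scope.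

Lemma order_of_injective N : injective (@order_of N).
Proof.
move=> i j /(congr1 (fun z => z + N%:Z)).
by rewrite /order_of !subrK => -[/val_inj].
Qed.

Lemma absz_order_of N (i : 'I_(N.*2.+1)) : (absz (order_of i) <= N)%N.
Proof.
by case: i => i iN; rewrite /order_of /=; lia.
Qed.

Lemma order_of_rev N (i : 'I_(N.*2.+1)) : order_of (rev_ord i) = - order_of i.
Proof. by case: i => i iN; rewrite /order_of /=; lia. Qed.

(** The extension F is the determinant of the same formulas, which make sense
    for every real rho whereas the cone does not. *)
Lemma star_det_extension N : exists F : R -> R[i], [/\ cexp_type F,
  (forall rho : R, - eps < rho < 1 -> star_det rho0 sigma N rho = F rho) & F 0 != 0].
Proof.
have /choice[G GP] (kl : 'I_(N.*2.+1) * 'I_(N.*2.+1)) : exists G, [/\ exp_type G, G 0 = 0,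
    forall x : R, is_derive x 1 G (polar_density N (order_of kl.1) (order_of kl.2) x) &
    forall rho : R, - eps < rho < 1 ->
      star_I rho0 sigma N (order_of kl.1) (order_of kl.2) rho =
      profile_fourier rho0 sigma G (order_of kl.1 - order_of kl.2) rho].
  exact: star_I_fourier hdef N (order_of kl.1) (order_of kl.2).
pose M rho : 'M[R[i]]_(N.*2.+1) := \matrix_(k, l)
  profile_fourier rho0 sigma (G (k, l)) (order_of k - order_of l) rho.
exists (fun rho => \det (M rho)); split.
- apply: cexp_type_det => k l; under eq_fun do rewrite mxE.
  by apply: (cexp_type_profile_fourier hdef); have [] := GP (k, l).
- move=> rho rI; congr (\det _); apply/matrixP => k l; rewrite !mxE.
  by have [_ _ _ ->] := GP (k, l).
have -> : M 0 = diag_mx (\row_k M 0 k k).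
  apply/matrixP => k l; rewrite !mxE; have [->|kl] := eqVneq k l.
    by rewrite mulr1n.
  by rewrite mulr0n profile_fourier_offdiag0// subr_eq0 (inj_eq (@order_of_injective N)).
rewrite det_diag; apply/prodf_neq0 => k _; rewrite !mxE subrr.
have [_ G0 dG _] := GP (k, k).
have Gr := polar_primitive_neq0 hdef (absz_order_of k) G0 dG.
rewrite eq_complex negb_and profile_fourier_diag0 /= mulf_neq0//.
by rewrite mulf_neq0// gt_eqF// pi_gt0.
Qed.

(** The conjugate of Y_N^{-k} is proportional to Y_N^k, so that the conjugates
    of the Y_N^l span all spherical harmonics of degree N. *)
Lemma sphY_conj N k (phi theta : R) : sphY N k phi theta =
  (sph_const N k / sph_const N (- k))%:C * ((sphY N (- k) phi theta)^*)%C.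
Proof.
rewrite !sphYE abszN; set a := Num.sqrt _ ^+ _ * _.
rewrite conj_real_expi mulrA -rmorphM /= rmorphN /= mulNr opprK.
by congr (_%:C * _); rewrite [RHS]mulrA divfK// sph_const_neq0.
Qed.

(** Expanded over the conjugates of the Y_N^l, the harmonic H has a nonzero
    coefficient vector, and its moments against the Y_{N+2}^k with |k| <= N are
    the image of this vector under the matrix of the determinant. *)
Lemma star_det_moments N H (rho : R) : - eps < rho < 1 -> star_det rho0 sigma N rho != 0 ->
  spherical_harmonic N H -> nonzero_on_sphere H ->
  exists m : 'I_((N + 2).*2.+1),
    sphere_integral (star_cone rho0 sigma rho `&` sphere)
      (fun phi theta => sphY (N + 2) (order_of m) phi theta * H phi theta) != 0.
Proof.
move=> rI D0 [c HE] [phi0 [theta0 [_ _ H0]]].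
pose e (l : 'I_(N.*2.+1)) := c (rev_ord l) *
  (sph_const N (- order_of l) / sph_const N (order_of l))%:C.
have HE' phi theta : H phi theta =
    \sum_l e l * ((sphY N (order_of l) phi theta)^*)%C.
  rewrite HE (reindex_inj rev_ord_inj); apply: eq_bigr => l _.
  by rewrite order_of_rev sphY_conj opprK /e mulrA.
pose M := \matrix_(k < N.*2.+1, l < N.*2.+1)
  star_I rho0 sigma N (order_of k) (order_of l) rho.
pose v := \col_l e l.
have v0 : v != 0.
  apply: contraNneq H0 => v0; rewrite HE' big1// => l _.
  by have /colP/(_ l) := v0; rewrite !mxE => ->; rewrite mul0r.
have uM : M \in unitmx by rewrite unitmxE unitfE.
have Mv : M *m v != 0.
  apply: contra_neq v0 => Mv; rewrite -[v]mul1mx -(mulVmx uM).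
  by rewrite -mulmxA Mv mulmx0.
have /existsP[k Mvk] : [exists k, (M *m v) k 0 != 0].
  apply: contraNT Mv; rewrite negb_exists => /forallP Z.
  by apply/eqP/colP => k; rewrite [RHS]mxE; apply/eqP; rewrite -[_ == _]negbK.
have km : (k + 2 < (N + 2).*2.+1)%N.
  by case: k {Mvk} => k kN /=; lia.
(* Index k in degree N and index k + 2 in degree N + 2 encode the same order. *)
exists (Ordinal km); apply: contra_neq Mvk => E.
rewrite mxE -[RHS]E /sphere_integral (star_region hdef)//.
have -> : order_of (Ordinal km) = order_of k by rewrite /order_of /=; lia.
pose f (l : 'I_(N.*2.+1)) (p : R * R) := sphY (N + 2) (order_of k) p.1 p.2 *
  ((sphY N (order_of l) p.1 p.2)^*)%C * (sin p.2)%:C.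
transitivity (cintegral (@leb2 R) (cap (profile rho0 sigma rho))
    (fun p => \sum_l e l * f l p)); last first.
  apply: eq_cintegral => p _; rewrite HE' mulr_sumr mulr_suml.
  by apply: eq_bigr => l _; rewrite /f; ring.
rewrite (cintegral_sum (measurable_cap (@continuous_profile _ _ _ _ hdef rho))).
  apply: eq_bigr => l _; rewrite !mxE mulrC; congr (_ * _).
  by rewrite /star_I /sphere_integral (star_region hdef).
by move=> l; exact: (cintegrable_integrand hdef).
Qed.

End Assembly.

Theorem proposition7p6 (R : realType) (rho0 : R) (sigma : R -> R) (eps : R)
  (hdef : star_deformation rho0 sigma eps)
  (hreg : forall rho : R, - eps < rho < 1 ->
     regular_cone (star_cone rho0 sigma rho)) :
  exists eps0 : R, 0 < eps0 < eps /\
    (forall N : nat,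
       real_analytic_on (star_det rho0 sigma N) [set rho : R | - eps0 < rho < 1] /\
       (exists rho : R, - eps0 < rho < 1 /\ star_det rho0 sigma N rho != 0)) /\
    (exists Z : set R, countable Z /\
       forall rho : R, - eps0 < rho < 1 -> ~ Z rho ->
         admissible_medium_cone (star_cone rho0 sigma rho)).
Proof.
have [_ _ _ _ [e0 _]] := hdef.
have e2 : 0 < eps / 2 by rewrite divr_gt0.
have sub (rho : R) : - (eps / 2) < rho < 1 -> - eps < rho < 1.
  by move=> /andP[r1 ->]; rewrite andbT; lra.
exists (eps / 2); rewrite e2 ltr_pdivrMr// ltr_pMr// ltr1n.
have /choice[F FP] N := star_det_extension hdef N.
have FE N (rho : R) : - (eps / 2) < rho < 1 -> star_det rho0 sigma N rho = F N rho.
  by move/sub; have [_ + _] := FP N; apply.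
split=> //; split=> [N|].
  have [eF _ F0] := FP N.
  have zI : - (eps / 2) < 0 :> R by rewrite oppr_lt0.
  split; last by exists 0; rewrite FE zI ltr01.
  apply: (cexp_type_real_analytic eF) => x xI.
  have : \forall y \near x, y \in `]- (eps / 2), 1[ by exact: near_in_itvoo.
  by apply: filterS => y; rewrite in_itv /=; exact: FE.
exists (\bigcup_N [set rho | F N rho = 0]); split.
  apply: bigcup_countable => // N _; have [eF _ F0] := FP N.
  exact: cexp_type_zeros_countable eF F0.
move=> rho rI nZ; have rI' := sub _ rI; split.
- rewrite star_cone_polar//; split; last by move=> t x; exact: polar_coneZ.
  apply: closed_polar_cone; first exact: (@continuous_profile _ _ _ _ hdef rho).
    by move=> phi; have /andP[/ltW] := profile_itv hdef phi rI'.
  exact: profile_2pi hdef _.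
- exists 1%:M; rewrite mul1mx trmx1; split=> //.
  rewrite (_ : [set x *m 1%:M | x in _] = star_cone rho0 sigma rho); first exact: hreg.
  apply/seteqP; split=> [_ [x Cx <-]|x Cx]; first by rewrite mulmx1.
  by exists x; rewrite ?mulmx1.
move=> N H Hsph H0; apply: (star_det_moments hdef rI') Hsph H0.
rewrite FE//; apply/eqP => FN; apply: nZ; exists N => //.
Qed.
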